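(* Let $\bar\pi=\{\bar\delta_0,\dots,\bar\delta_N\}$ be a periodic triggering policy with period $k_p$, and let $\pi^+$ be the triggering policy $\delta_k^+=\mathbf{1}_{\{\mathrm{VoI}^{\bar\pi}_k\ge0\}}$, where $\mathrm{VoI}^{\bar\pi}_k$ is the value of information with $\varrho_k$ replaced by $\varrho^{\bar\pi}_k$. Then, in both the perfect and the imperfect information settings, $\Psi(\pi^+,\mu^* )\le\Psi(\bar\pi,\mu^* )$, where $\mu^*$ is the control policy $u_k=-L_k\hat x_k$.
   Context: Setting (common): $x_{k+1}=A_kx_k+B_ku_k+w_k$, $k=0,\dots,N$, $x_0\sim\mathcal N(m_0,M_0)$, $w_k$ i.i.d. $\mathcal N(0,W_k)$, $W_k\succ0$, $(A_k,B_k)$ controllable; an event trigger chooses $\delta_k\in\{0,1\}$ and the observation at time $k$ is transmitted to the controller with one-step delay iff $\delta_k=1$; information associated with non-transmitted observations is discarded at the controller. Cost $\Psi(\pi,\mu)=\mathbb{E}\big[x_{N+1}^TQ_{N+1}x_{N+1}+\sum_{k=0}^Nx_k^TQ_kx_k+u_k^TR_ku_k+\theta_k\delta_k\big]$, $Q_k\succeq0$, $R_k\succ0$, $\theta_k\ge0$. Riccati: $S_{N+1}=Q_{N+1}$, $S_k=Q_k+A_k^TS_{k+1}A_k-\Gamma_k$, $\Gamma_k=A_k^TS_{k+1}B_k(B_k^TS_{k+1}B_k+R_k)^{-1}B_k^TS_{k+1}A_k$, $\Gamma_{N+1}=0$, $L_k=(B_k^TS_{k+1}B_k+R_k)^{-1}B_k^TS_{k+1}A_k$.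 Perfect information: observation $x_k$; $\mathcal{I}^e_k=\{x_t:t\le k\}$, $\mathcal{I}^c_k=\{x_t:t<k,\delta_t=1\}$; $\hat x_0=m_0$, $\hat x_k=A_{k-1}\hat x_{k-1}+B_{k-1}u_{k-1}+\delta_{k-1}A_{k-1}(x_{k-1}-\hat x_{k-1})$; $e_k=x_k-\hat x_k$; value of information $\mathrm{VoI}_k=e_k^TA_k^T\Gamma_{k+1}A_ke_k-\theta_k+\varrho_k$. Imperfect information: observation $y_k=C_kx_k+v_k$, $v_k$ i.i.d. $\mathcal N(0,V_k)$, $V_k\succ0$, $(A_k,C_k)$ observable; $\mathcal{I}^e_k=\{y_t:t\le k\}$, $\mathcal{I}^c_k=\{y_t:t<k,\delta_t=1\}$; $\check x_k=\mathbb{E}[x_k\mid\mathcal{I}^e_k]$ (Kalman filter); $\hat x_0=m_0$, $P_0=M_0$, $\hat x_k=A_{k-1}\hat x_{k-1}+B_{k-1}u_{k-1}+\delta_{k-1}K_{k-1}(y_{k-1}-C_{k-1}\hat x_{k-1})$, $P_k=A_{k-1}P_{k-1}A_{k-1}^T+W_{k-1}-\delta_{k-1}K_{k-1}C_{k-1}P_{k-1}A_{k-1}^T$, $K_k=A_kP_kC_k^T(C_kP_kC_k^T+V_k)^{-1}$; $e_k=x_k-\hat x_k$, $\nu_k=y_k-C_k\hat x_k$, $\varepsilon_k=\check x_k-\hat x_k$; value of information $\mathrm{VoI}_k=\nu_k^TK_k^T\Gamma_{k+1}(2A_k\varepsilon_k-K_k\nu_k)-\theta_k+\varrho_k$. Approximation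 (Algorithm 1): for the periodic policy $\bar\pi$, $\varrho^{\bar\pi}_k=\mathbb{E}[V^{\bar\pi}_{k+1}\mid\mathcal{I}^e_k,\delta_k=0]-\mathbb{E}[V^{\bar\pi}_{k+1}\mid\mathcal{I}^e_k,\delta_k=1]$ where $\mathbb{E}[V^{\bar\pi}_{k+1}\mid\mathcal{I}^e_k,\delta_k]=\mathbb{E}\big[\sum_{t=k+1}^N\theta_t\delta_t+e_{t+1}^T\Gamma_{t+1}e_{t+1}\mid\mathcal{I}^e_k,\delta_k\big]$ computed with $\delta_t=\bar\delta_t$ for all $t\ge k+1$ and control $u_t=-L_t\hat x_t$. *)

(* Defs.v *)
From HB Require Import structures.
From mathcomp Require Import all_boot all_order all_algebra.
From mathcomp Require Import all_classical all_reals all_analysis.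
Set Implicit Arguments. Unset Strict Implicit. Unset Printing Implicit Defensive.
Import Order.TTheory GRing.Theory Num.Theory.
Local Open Scope classical_set_scope.
Local Open Scope ring_scope.

Definition qf (R : realType) (q : nat) (M : 'M[R]_q) (z : 'cV[R]_q) : R :=
  ((z^T *m M *m z) 0 0).

Definition psd (R : realType) (q : nat) (M : 'M[R]_q) : Prop :=
  M^T = M /\ forall z : 'cV[R]_q, 0 <= qf M z.

Definition pd (R : realType) (q : nat) (M : 'M[R]_q) : Prop :=
  M^T = M /\ forall z : 'cV[R]_q, z != 0 -> 0 < qf M z.

Definition controllable (R : realType) (n m : nat) (A : 'M[R]_n) (B : 'M[R]_(n, m)) : Prop :=
  \rank (\mxrow_(i < n) (A ^+ i *m B)) = n.

Definition observable (R : realType) (n p : nat) (A : 'M[R]_n) (C : 'M[R]_(p, n)) : Prop :=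
  \rank (\mxcol_(i < n) (C *m A ^+ i)) = n.

Record lqsys (R : realType) (n m : nat) := LQSys {
  horizon : nat;
  Am : nat -> 'M[R]_n;
  Bm : nat -> 'M[R]_(n, m);
  Wm : nat -> 'M[R]_n;
  Qm : nat -> 'M[R]_n;
  Rm : nat -> 'M[R]_m;
  theta : nat -> R }.

Section Riccati.
Context {R : realType} {n m : nat} (sys : lqsys R n m).
Local Notation N := (horizon sys).
Local Notation A := (Am sys).
Local Notation B := (Bm sys).

Definition GamOf (S1 : 'M[R]_n) (k : nat) : 'M[R]_n :=
  (A k)^T *m S1 *m B k *m invmx ((B k)^T *m S1 *m B k + Rm sys k)
    *m (B k)^T *m S1 *m A k.

(* Sback j = S_{N+1-j} *)
Fixpoint Sback (j : nat) : 'M[R]_n :=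
  match j with
  | 0 => Qm sys N.+1
  | j'.+1 => let k := (N - j')%N in
             let S1 := Sback j' in
             Qm sys k + (A k)^T *m S1 *m A k - GamOf S1 k
  end.

Definition Ric (k : nat) : 'M[R]_n := Sback (N.+1 - k).

Definition Gam (k : nat) : 'M[R]_n :=
  if (k <= N)%N then GamOf (Ric k.+1) k else 0.

Definition Lgain (k : nat) : 'M[R]_(m, n) :=
  invmx ((B k)^T *m Ric k.+1 *m B k + Rm sys k) *m (B k)^T *m Ric k.+1 *m A k.

End Riccati.

Section Prob.
Context {R : realType} {d : measure_display} {T : measurableType d}.
Variable P : probability T R.

Definition rv_vec (q : nat) (X : T -> 'cV[R]_q) : Prop :=
  forall i : 'I_q, measurable_fun setT (fun t => X t i 0).

(* X ~ N(mu, M): M is a covariance matrix and every linear combination a^T X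
   is (univariate) normal with mean a^T mu and variance a^T M a
   (degenerate variance 0 meaning a Dirac mass) *)
Definition gauss_vec (q : nat) (X : T -> 'cV[R]_q) (mu : 'cV[R]_q) (M : 'M[R]_q) : Prop :=
  psd M /\
  forall a : 'cV[R]_q, forall B : set R, measurable B ->
    let s2 := qf M a in
    let mean := (a^T *m mu) 0 0 in
    P ((fun t => (a^T *m X t) 0 0) @^-1` B) =
      (if s2 == 0 then (\1_B mean)%:E else normal_prob mean (Num.sqrt s2) B).

Definition vsigma (q : nat) (X : T -> 'cV[R]_q) : set (set T) :=
  <<s [set E | exists (i : 'I_q) (B : set R), measurable B /\
               E = (fun t => X t i 0) @^-1` B] >>.

Definition hist_sigma (q : nat) (Y : nat -> T -> 'cV[R]_q) (k : nat) : set (set T) :=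
  <<s [set E | exists (j : nat) (i : 'I_q) (B : set R), (j <= k)%N /\ measurable B /\
               E = (fun t => Y j t i 0) @^-1` B] >>.

Definition mutually_indep (I : eqType) (valid : I -> Prop) (F : I -> set (set T)) : Prop :=
  forall (J : seq I) (E : I -> set T),
    uniq J -> (forall j, j \in J -> valid j /\ F j (E j)) ->
    P (\big[setI/setT]_(j <- J) E j) = (\prod_(j <- J) fine (P (E j)))%:E.

Definition cond_exp_of (G : set (set T)) (X Y : T -> R) : Prop :=
  (forall B : set R, measurable B -> G (Y @^-1` B)) /\
  P.-integrable setT (EFin \o Y) /\
  forall E, G E -> (\int[P]_(t in E) (X t)%:E = \int[P]_(t in E) (Y t)%:E)%E.

End Prob.

(* state = (x_k, xhat_k); trigger rule trig k omega state = delta_k     *)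

Section Perfect.
Context {R : realType} {d : measure_display} {T : measurableType d} {n m : nat}.
Variables (sys : lqsys R n m) (m0 : 'cV[R]_n) (x0 : T -> 'cV[R]_n) (w : nat -> T -> 'cV[R]_n).
Local Notation N := (horizon sys).
Local Notation A := (Am sys).
Local Notation B := (Bm sys).

Definition pstep (k : nat) (s : 'cV[R]_n * 'cV[R]_n) (dl : bool) (wk : 'cV[R]_n) :=
  let u := - (Lgain sys k *m s.2) in
  (A k *m s.1 + B k *m u + wk,
   A k *m s.2 + B k *m u + (dl%:R : R) *: (A k *m (s.1 - s.2))).

Fixpoint prun (trig : nat -> T -> 'cV[R]_n * 'cV[R]_n -> bool) (k0 : nat)
    (s0 : T -> 'cV[R]_n * 'cV[R]_n) (j : nat) (t : T) : 'cV[R]_n * 'cV[R]_n :=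
  match j with
  | 0 => s0 t
  | j'.+1 => let s := prun trig k0 s0 j' t in
             pstep (k0 + j') s (trig (k0 + j')%N t s) (w (k0 + j') t)
  end.

Definition pclosed trig (k : nat) (t : T) := prun trig 0 (fun t => (x0 t, m0)) k t.

Definition pcost trig (t : T) : R :=
  let s k := pclosed trig k t in
  qf (Qm sys N.+1) (s N.+1).1 +
  \sum_(k < N.+1) (qf (Qm sys k) (s k).1 + qf (Rm sys k) (- (Lgain sys k *m (s k).2))
                   + theta sys k * ((trig k t (s k))%:R : R)).

Definition pPsi (P : probability T R) trig : \bar R := (\int[P]_t (pcost trig t)%:E)%E.

Definition pIe trig (k : nat) := hist_sigma (fun j t => (pclosed trig j t).1) k.

(* V^{pibar}_{k+1} given delta_k = dl: from the closed-loop state at time k,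
   apply delta_k = dl and delta_t = dbar_t for t >= k+1, control -L_t xhat_t;
   sum_{t=k+1}^N theta_t delta_t + e_{t+1}^T Gamma_{t+1} e_{t+1} *)
Definition pVcf trig (dbar : nat -> bool) (k : nat) (dl : bool) (t : T) : R :=
  let s' j := prun (fun k' _ _ => if k' == k then dl else dbar k') k
                   (pclosed trig k) j t in
  \sum_(k.+1 <= j < N.+1)
     (theta sys j * ((dbar j)%:R : R)
      + qf (Gam sys j.+1) ((s' (j.+1 - k)%N).1 - (s' (j.+1 - k)%N).2)).

Definition pplus (rho : nat -> T -> R) (k : nat) (t : T) (s : 'cV[R]_n * 'cV[R]_n) : bool :=
  0 <= qf ((A k)^T *m Gam sys k.+1 *m A k) (s.1 - s.2) - theta sys k + rho k t.

End Perfect.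

Section Imperfect.
Context {R : realType} {d : measure_display} {T : measurableType d} {n m p : nat}.
Variables (sys : lqsys R n m) (C : nat -> 'M[R]_(p, n)) (V : nat -> 'M[R]_p)
  (m0 : 'cV[R]_n) (M0 : 'M[R]_n)
  (x0 : T -> 'cV[R]_n) (w : nat -> T -> 'cV[R]_n) (v : nat -> T -> 'cV[R]_p).
Local Notation N := (horizon sys).
Local Notation A := (Am sys).
Local Notation B := (Bm sys).

Definition istate := ('cV[R]_n * 'cV[R]_n * 'M[R]_n)%type.

Definition Kgain (k : nat) (Pk : 'M[R]_n) : 'M[R]_(n, p) :=
  A k *m Pk *m (C k)^T *m invmx (C k *m Pk *m (C k)^T + V k).

Definition istep (k : nat) (s : istate) (dl : bool) (wk : 'cV[R]_n) (vk : 'cV[R]_p) : istate :=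
  let: (x, xh, Pk) := s in
  let u := - (Lgain sys k *m xh) in
  let y := C k *m x + vk in
  let K := Kgain k Pk in
  (A k *m x + B k *m u + wk,
   A k *m xh + B k *m u + (dl%:R : R) *: (K *m (y - C k *m xh)),
   A k *m Pk *m (A k)^T + Wm sys k - (dl%:R : R) *: (K *m C k *m Pk *m (A k)^T)).

Fixpoint irun (trig : nat -> T -> istate -> bool) (k0 : nat)
    (s0 : T -> istate) (j : nat) (t : T) : istate :=
  match j with
  | 0 => s0 t
  | j'.+1 => let s := irun trig k0 s0 j' t in
             istep (k0 + j') s (trig (k0 + j')%N t s) (w (k0 + j') t) (v (k0 + j') t)
  end.

Definition iclosed trig (k : nat) (t : T) : istate :=
  irun trig 0 (fun t => (x0 t, m0, M0)) k t.

Definition ix (s : istate) : 'cV[R]_n := s.1.1.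
Definition ixh (s : istate) : 'cV[R]_n := s.1.2.
Definition iP (s : istate) : 'M[R]_n := s.2.

Definition iobs trig (k : nat) (t : T) : 'cV[R]_p := C k *m ix (iclosed trig k t) + v k t.

Definition icost trig (t : T) : R :=
  let s k := iclosed trig k t in
  qf (Qm sys N.+1) (ix (s N.+1)) +
  \sum_(k < N.+1) (qf (Qm sys k) (ix (s k)) + qf (Rm sys k) (- (Lgain sys k *m ixh (s k)))
                   + theta sys k * ((trig k t (s k))%:R : R)).

Definition iPsi (P : probability T R) trig : \bar R := (\int[P]_t (icost trig t)%:E)%E.

Definition iIe trig (k : nat) := hist_sigma (iobs trig) k.

Definition iVcf trig (dbar : nat -> bool) (k : nat) (dl : bool) (t : T) : R :=
  let s' j := irun (fun k' _ _ => if k' == k then dl else dbar k') k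
                   (iclosed trig k) j t in
  \sum_(k.+1 <= j < N.+1)
     (theta sys j * ((dbar j)%:R : R)
      + qf (Gam sys j.+1) (ix (s' (j.+1 - k)%N) - ixh (s' (j.+1 - k)%N))).

Definition iplus (rho : nat -> T -> R) (xc : nat -> T -> 'cV[R]_n)
    (k : nat) (t : T) (s : istate) : bool :=
  let K := Kgain k (iP s) in
  let nu := C k *m ix s + v k t - C k *m ixh s in
  let eps := xc k t - ixh s in
  0 <= ((nu^T *m K^T *m Gam sys k.+1 *m (2%:R *: (A k *m eps) - K *m nu)) 0 0)
       - theta sys k + rho k t.

End Imperfect.

Inductive noise_idx := NX0 | NW of nat | NV of nat.
Definition noise_idx_code (i : noise_idx) : nat + (nat + nat) :=
  match i with NX0 => inl 0%N | NW k => inr (inl k) | NV k => inr (inr k) end.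
Definition noise_idx_decode (c : nat + (nat + nat)) : noise_idx :=
  match c with inl _ => NX0 | inr (inl k) => NW k | inr (inr k) => NV k end.
Lemma noise_idx_codeK : cancel noise_idx_code noise_idx_decode.
Proof. by case. Qed.
HB.instance Definition _ := Equality.copy noise_idx (can_type noise_idx_codeK).

(* Main.v *)
(* Completing squares along the Riccati recursion, the cost of any triggering rule under
   u_k = - L_k xhat_k is a policy-independent noise term, plus
   sum_k theta_k delta_k + e_{k+1}^T Gamma_{k+1} e_{k+1}, plus cross terms
   w_k^T S_{k+1} (A_k x_k + B_k u_k) of zero mean. It remains to compare the middle sums.
   Interpolate between the two policies by the hybrids that follow pi^+ before time k and
   pibar from k on. Passing from the k-th hybrid to the next changes only the decision at
   time k, and the conditional gain of delta_k = 1 over delta_k = 0 given I^e_k is exactly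
   VoI_k; as pi^+ triggers iff VoI_k >= 0, no such passage increases the cost. *)
Require Import Defs.
From HB Require Import structures.
From mathcomp Require Import all_boot all_order all_algebra.
From mathcomp Require Import all_classical all_reals all_analysis.
From mathcomp Require Import measurable_realfun ring lra.
Import Order.TTheory GRing.Theory Num.Theory.
Import numFieldNormedType.Exports.
Local Open Scope classical_set_scope.
Local Open Scope ring_scope.
Set Implicit Arguments.
Unset Strict Implicit.
Unset Printing Implicit Defensive.

(** * Measurability and integrability relative to a sub-sigma-algebra *)

(** The trigger compares VoI_k with 0 at each sample point, yet VoI_k is the gain of transmitting
    only after conditioning. The difference is a finite sum of products, each a weight known from
    I^e_k times a factor of zero conditional expectation: the noise w_k, the estimation error x_k -
    xcheck_k, or the error of one of the two predictions behind varrho_k. The estimate is only known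
    to be integrable and its weights are unbounded, so these products may fail to be integrable;
    hence a truncation in place of the tower property. Two filtrations appear. I^e_k depends on the
    policy through the observations, so cross terms and integrability are treated in the filtration
    of past noise, which serves all policies and contains I^e_k along the loop of pi^+. That
    inclusion looks circular, as observations depend on decisions and decisions on observations;
    strong induction on time resolves it. The two information patterns differ in the vector g_k that
    a transmission adds to xhat_{k+1}, A_k e_k or K_k nu_k, and in the estimate of x_k; one argument
    with g_k abstract serves both. *)

Section SubSigma.
Context {R : realType} {d : measure_display} {T : measurableType d}.
Implicit Types (G H : set (set T)) (f g : T -> R).

(** [G] is a generating family. Retyping the domain as [g_sigma_algebraType G] makes the closure
    lemmas for [measurable_fun] available for the generated sub-sigma-algebra. *)
Definition gmeas G f : Prop :=
  measurable_fun (setT : set (g_sigma_algebraType G)) (f : g_sigma_algebraType G -> R).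

Definition gbool G (b : T -> bool) : Prop := <<s G >> [set t | b t].

Lemma gmeas_measurable G f : G `<=` measurable -> gmeas G f -> measurable_fun setT f.
Proof.
move=> Gm mf mT B mB; have := mf measurableT B mB.
by apply: smallest_sub => //; exact: sigma_algebra_measurable.
Qed.

Lemma gmeas_sub G H f : G `<=` <<s H >> -> gmeas G f -> gmeas H f.
Proof.
move=> GH mf mT B mB; have := mf measurableT B mB.
by apply: smallest_sub => //; exact: smallest_sigma_algebra.
Qed.

Lemma gbool_sub G H b : G `<=` <<s H >> -> gbool G b -> gbool H b.
Proof. by move=> GH; apply: smallest_sub => //; exact: smallest_sigma_algebra. Qed.

Lemma gmeasP G f : (forall B : set R, measurable B -> <<s G >> (f @^-1` B)) -> gmeas G f.
Proof. by move=> Gf _ B mB; rewrite setTI; exact: Gf. Qed.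

Lemma gmeas_if G b f g : gbool G b -> gmeas G f -> gmeas G g ->
  gmeas G (fun t => if b t then f t else g t).
Proof.
move=> Gb; apply: measurable_fun_ifT; apply: (@measurable_fun_bool _ _ _ _ true).
by rewrite setTI.
Qed.

Lemma gmeas_bool G b f : gbool G b -> gmeas G f -> gmeas G (fun t => (b t)%:R * f t).
Proof.
move=> Gb Gf; have : gmeas G (fun t => if b t then f t else 0).
  by apply: gmeas_if => //; exact: measurable_cst.
by congr gmeas; apply/funext => t; case: (b t); rewrite ?mul1r ?mul0r.
Qed.

Lemma gbool_cst G (b : bool) : gbool G (fun=> b).
Proof.
case: b; rewrite /gbool.
  rewrite (_ : [set _ | _] = setT); last by apply/seteqP; split.
  exact: (@measurableT _ (g_sigma_algebraType G)).
rewrite (_ : [set _ | _] = set0); last by apply/seteqP; split.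
exact: (@measurable0 _ (g_sigma_algebraType G)).
Qed.

Lemma gbool_neg G b : gbool G b -> gbool G (fun t => ~~ b t).
Proof.
move=> /sigma_algebraC; congr (<<s _ >> _).
by apply/seteqP; split=> t /=; [move/negP|move=> /negP].
Qed.

Lemma gbool_and G (a b : T -> bool) : gbool G a -> gbool G b ->
  gbool G (fun t => a t && b t).
Proof.
move=> Ga Gb.
rewrite /gbool (_ : [set t | _] = [set t | a t] `&` [set t | b t]).
  exact: (@measurableI _ (g_sigma_algebraType G)).
by apply/seteqP; split=> t /= /andP.
Qed.

Lemma gbool_ler G f g : gmeas G f -> gmeas G g -> gbool G (fun t => f t <= g t).
Proof.
move=> Gf Gg.
by have := measurable_fun_le measurableT Gf Gg; rewrite setTI.
Qed.

End SubSigma.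

(** * Integrable and square-integrable functions on a probability space *)

Section Integrability.
Context {R : realType} {d : measure_display} {T : measurableType d}.
Variable P : probability T R.
Implicit Types (f g : T -> R).

Definition rint f : Prop := P.-integrable setT (EFin \o f).

Lemma rint_measurable f : rint f -> measurable_fun setT f.
Proof. by move=> /measurable_int/measurable_EFinP. Qed.

Lemma rintD f g : rint f -> rint g -> rint (fun t => f t + g t).
Proof. by move=> /integrableD h /h{}h; exact: h. Qed.

Lemma rintN f : rint f -> rint (fun t => - f t).
Proof. by move=> /integrableN h; exact: h. Qed.

Lemma rintB f g : rint f -> rint g -> rint (fun t => f t - g t).
Proof. by move=> rf /rintN; exact: rintD. Qed.

Lemma rintZ c f : rint f -> rint (fun t => c * f t).
Proof. by move=> /integrableZl h; exact: h. Qed.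

Lemma rint_cst c : rint (fun=> c).
Proof. exact: finite_measure_integrable_cst. Qed.

Lemma rint_sum (I : Type) (s : seq I) (F : I -> T -> R) :
  (forall i, rint (F i)) -> rint (fun t => \sum_(i <- s) F i t).
Proof.
move=> rF; elim: s => [|i s ih].
  by have := rint_cst 0; congr rint; apply/funext => t; rewrite big_nil.
have := rintD (rF i) ih; congr rint.
by apply/funext => t; rewrite big_cons.
Qed.

Lemma rint_le f g : measurable_fun setT f -> (forall t, `|f t| <= `|g t|) ->
  rint g -> rint f.
Proof.
move=> mf fg; apply: le_integrable => //; first exact/measurable_EFinP.
by move=> t _ /=; rewrite lee_fin.
Qed.

Lemma rint_bool G (b : T -> bool) f : G `<=` measurable -> gbool G b -> rint f ->
  rint (fun t => (b t)%:R * f t).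
Proof.
move=> Gm Gb rf; apply: (@rint_le _ f) => //; last first.
  by move=> t; case: (b t); rewrite ?mul1r// mul0r normr0.
have := measurable_fun_ifT (f := b) (g := f) (h := fun=> 0).
have mb : measurable_fun setT b.
  apply: (@measurable_fun_bool _ _ _ _ true); rewrite setTI.
  by apply: smallest_sub Gb => //; exact: sigma_algebra_measurable.
move=> /(_ mb (rint_measurable rf) (measurable_cst _)).
by congr measurable_fun; apply/funext => t; case: (b t); rewrite ?mul1r ?mul0r.
Qed.

Definition L2 f : Prop := measurable_fun setT f /\ rint (fun t => f t ^+ 2).

Lemma L2_le f g : measurable_fun setT f -> (forall t, `|f t| <= `|g t|) -> L2 g -> L2 f.
Proof.
move=> mf fg [mg rg]; split=> //; apply: rint_le rg; first exact: measurable_funX.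
by move=> t; rewrite !normrX lerXn2r ?nnegrE.
Qed.

Lemma L2_cst c : L2 (fun=> c).
Proof. by split; [exact: measurable_cst | exact: rint_cst]. Qed.

Lemma L2D f g : L2 f -> L2 g -> L2 (fun t => f t + g t).
Proof.
move=> [mf rf] [mg rg]; have mfg : measurable_fun setT (fun t => f t + g t).
  exact: measurable_funD.
split=> //; apply: rint_le (rintD (rintZ 2 rf) (rintZ 2 rg)).
  exact: measurable_funX.
move=> t; rewrite ger0_norm ?sqr_ge0// ler_normr; apply/orP; left.
by have := sqr_ge0 (f t - g t); nra.
Qed.

Lemma L2Z c f : L2 f -> L2 (fun t => c * f t).
Proof.
move=> [mf rf]; split; first exact: measurable_funM.
by have := rintZ (c ^+ 2) rf; congr rint; apply/funext => t; rewrite exprMn.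
Qed.

Lemma L2N f : L2 f -> L2 (fun t => - f t).
Proof.
by move=> /(L2Z (-1)); congr L2; apply/funext => t; rewrite mulN1r.
Qed.

Lemma L2_sum (I : Type) (s : seq I) (F : I -> T -> R) :
  (forall i, L2 (F i)) -> L2 (fun t => \sum_(i <- s) F i t).
Proof.
move=> rF; elim: s => [|i s ih].
  by have := L2_cst 0; congr L2; apply/funext => t; rewrite big_nil.
have := L2D (rF i) ih; congr L2.
by apply/funext => t; rewrite big_cons.
Qed.

Lemma L2_bounded_mul (c : R) (h f : T -> R) : measurable_fun setT h -> (forall t, `|h t| <= c) ->
  L2 f -> L2 (fun t => h t * f t).
Proof.
move=> mh hc Lf; apply: (@L2_le _ (fun t => c * f t)); last exact: L2Z.
  by apply: measurable_funM => //; case: Lf.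
by move=> t; rewrite !normrM ler_wpM2r// (le_trans (hc t)) ?ler_norm.
Qed.

(** The bound [|f g| <= f ^+ 2 + g ^+ 2] follows from the squares of the sum and of the
    difference. *)
Lemma L2_mul_rint f g : L2 f -> L2 g -> rint (fun t => f t * g t).
Proof.
move=> [mf rf] [mg rg]; apply: rint_le (rintD rf rg); first exact: measurable_funM.
move=> t; rewrite [leRHS]ger0_norm ?addr_ge0 ?sqr_ge0// ler_norml.
by apply/andP; split; have := sqr_ge0 (f t - g t); have := sqr_ge0 (f t + g t); nra.
Qed.

Lemma L2_rint f : L2 f -> rint f.
Proof.
move=> Lf; have := L2_mul_rint Lf (L2_cst 1); congr rint.
by apply/funext => t; rewrite mulr1.
Qed.

Lemma RintD f g : rint f -> rint g ->
  \int[P]_t (f t + g t) = \int[P]_t f t + \int[P]_t g t.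
Proof. by move=> rf rg; rewrite RintegralD. Qed.

Lemma RintB f g : rint f -> rint g ->
  \int[P]_t (f t - g t) = \int[P]_t f t - \int[P]_t g t.
Proof. by move=> rf rg; rewrite RintegralB. Qed.

Lemma RintE f : rint f -> (\int[P]_t (f t)%:E)%E = (\int[P]_t f t)%:E.
Proof. by move=> rf; rewrite /Rintegral fineK//; exact: integrable_fin_num. Qed.

Lemma Rint_sum (I : Type) (s : seq I) (F : I -> T -> R) :
  (forall i, rint (F i)) ->
  \int[P]_t (\sum_(i <- s) F i t) = \sum_(i <- s) \int[P]_t F i t.
Proof.
move=> rF; elim: s => [|i s ih].
  under eq_Rintegral do rewrite big_nil.
  by rewrite big_nil Rintegral_cst// mul0r.
under eq_Rintegral do rewrite big_cons.
by rewrite big_cons RintD//; [rewrite ih | exact: rint_sum].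
Qed.

End Integrability.

Import HBNNSimple.

(** * Functions of zero conditional expectation and their products with known weights *)

Section Orthogonality.
Context {R : realType} {d : measure_display} {T : measurableType d}.
Variable P : probability T R.
Implicit Types (X Y F : T -> R).

(** This says E[X | sigma(G)] = 0 by testing on events, so that no conditional expectation has to be
    constructed. *)
Definition orth (G : set (set T)) X : Prop :=
  rint P X /\ forall E, <<s G >> E -> (\int[P]_(t in E) (X t)%:E = 0)%E.

Lemma orth_sub G H X : G `<=` <<s H >> -> orth H X -> orth G X.
Proof.
move=> GH [rX oX]; split=> // E GE; apply: oX.
by apply: smallest_sub GE => //; exact: smallest_sigma_algebra.
Qed.

Lemma orth_cond_exp G X Z : <<s G >> `<=` measurable -> rint P X ->
  cond_exp_of P <<s G >> X Z -> orth G (fun t => X t - Z t).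
Proof.
move=> Gm rX [_ [rZ XZ]]; split; first exact: rintB.
move=> E GE; have mE := Gm _ GE.
have rXE := integrableS measurableT mE (@subsetT _ _) rX.
have rZE := integrableS measurableT mE (@subsetT _ _) rZ.
rewrite (integralB mE rXE rZE) XZ// subee//.
exact: integrable_fin_num.
Qed.

Variables (G : set (set T)) (Gm : G `<=` measurable).

Let sGm : <<s G >> `<=` measurable.
Proof. by apply: smallest_sub => //; exact: sigma_algebra_measurable. Qed.

Lemma rint_indic E X : measurable E -> rint P X -> rint P (fun t => \1_E t * X t).
Proof.
move=> mE rX; apply: (rint_le _ _ rX).
  apply: measurable_funM; first exact: measurable_indic.
  exact: (rint_measurable rX).
by move=> t; rewrite normrM indicE; case: (t \in E); rewrite ?normr1 ?mul1r// normr0 mul0r.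
Qed.

Lemma Rint_indic E X : \int[P]_t (\1_E t * X t) = fine (\int[P]_(t in E) (X t)%:E).
Proof.
rewrite /Rintegral [in RHS]integral_mkcond; congr fine; apply: eq_integral => t _.
by rewrite patchE indicE; case: (t \in E); rewrite ?mul1r ?mul0r.
Qed.

(** A simple function is a combination of indicators of its level sets, which are events of the
    sub-sigma-algebra. *)
Lemma orth_simple (h : {nnsfun (g_sigma_algebraType G) >-> R}) X : orth G X ->
  rint P (fun t => h t * X t) /\ \int[P]_t (h t * X t) = 0.
Proof.
move=> [rX oX].
have [N [a ha]] : exists N (a : 'I_N -> R),
    forall t, h t = \sum_(i < N) a i * \1_(h @^-1` [set a i]) t.
  by eexists; eexists => t; exact: (fimfunEord h t).
have hE : (fun t => h t * X t) =
    (fun t => \sum_(i < N) a i * (\1_(h @^-1` [set a i]) t * X t)).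
  apply/funext => t; rewrite {1}ha mulr_suml.
  by apply: eq_bigr => i _; rewrite mulrA.
have Gh y : <<s G >> (h @^-1` [set y]) by exact: (measurable_sfunP h).
have rh y : rint P (fun t => \1_(h @^-1` [set y]) t * X t).
  by apply: rint_indic => //; exact: sGm.
rewrite hE; split; first by apply: rint_sum => i; exact: rintZ.
rewrite Rint_sum; last by move=> i; exact: rintZ.
apply: big1 => i _; rewrite RintegralZl//; last exact: rh.
by rewrite Rint_indic oX// mulr0.
Qed.

(** Simple functions increase to [Y]; the products with [X] are dominated by [|Y X|], so the zero
    integrals pass to the limit. *)
Lemma orth_mul_ge0 X Y : orth G X -> gmeas G Y -> (forall t, 0 <= Y t) ->
  rint P (fun t => Y t * X t) -> \int[P]_t (Y t * X t) = 0.
Proof.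
move=> oX GY Y0 rYX.
have mY : measurable_fun (setT : set (g_sigma_algebraType G)) (EFin \o Y).
  exact/measurable_EFinP.
pose h := nnsfun_approx measurableT mY.
have cvghY t : h n t @[n --> \oo] --> Y t.
  have : (EFin \o h ^~ t) @ \oo --> (Y t)%:E.
    by apply: cvg_nnsfun_approx => // x _; rewrite lee_fin.
  by move=> /fine_cvgP[].
have hY n t : h n t <= Y t.
  rewrite -(cvg_lim _ (cvghY t))//; apply: nondecreasing_cvgn_le.
    by move=> a b ab; have /lefP := nd_nnsfun_approx measurableT mY ab; exact.
  by apply/cvg_ex; exists (Y t).
have Gh n : gmeas G (fun t => h n t) by exact: (@measurable_funPT _ _ _ _ (h n)).
have mh n : measurable_fun setT (fun t : T => h n t) by exact: gmeas_measurable (Gh n).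
have mX : measurable_fun setT X by case: oX => /rint_measurable.
have mhX n : measurable_fun setT (fun t : T => (h n t * X t)%:E).
  exact/measurable_EFinP/measurable_funM.
have mYX : measurable_fun setT (fun t => (Y t * X t)%:E).
  by apply/measurable_EFinP; exact: (rint_measurable rYX).
have cvgh : {ae P, forall t : T, setT t -> (h n t * X t)%:E @[n --> \oo] --> (Y t * X t)%:E}.
  apply: aeW => t _; apply/fine_cvgP; split; first exact: nearW.
  have hX : h n t * X t @[n --> \oo] --> Y t * X t by apply: cvgMr_tmp; exact: cvghY.
  exact: hX.
have dom : {ae P, forall (t : T) n, setT t -> (`|(h n t * X t)%:E| <= `|(Y t * X t)%:E|)%E}.
  apply: aeW => t n _; rewrite lee_fin !normrM ler_wpM2r//.
  by rewrite !ger0_norm.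
have [_ _] := dominated_convergence measurableT mhX mYX cvgh (integrable_abse rYX) dom.
move=> /cvg_lim => /(_ (@ereal_hausdorff R)); rewrite /Rintegral => <-.
rewrite (_ : [sequence _]_n = cst 0%E) ?lim_cst//.
apply/funext => n; have [rh ih] := orth_simple (h n) oX.
by rewrite /= RintE// ih.
Qed.

Lemma orth_mul X Y : orth G X -> gmeas G Y -> rint P (fun t => Y t * X t) ->
  \int[P]_t (Y t * X t) = 0.
Proof.
move=> oX GY rYX.
have mX : measurable_fun setT X by case: oX => /rint_measurable.
pose Yp t := Num.max (Y t) 0; pose Yn t := Num.max (- Y t) 0.
have GYp : gmeas G Yp by apply: measurable_maxr => //; exact: measurable_cst.
have GYn : gmeas G Yn.
  by apply: measurable_maxr; [exact: measurableT_comp | exact: measurable_cst].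
have Yp0 t : 0 <= Yp t by rewrite le_max lexx orbT.
have Yn0 t : 0 <= Yn t by rewrite le_max lexx orbT.
have rp Z : gmeas G Z -> (forall t, `|Z t| <= `|Y t|) -> rint P (fun t => Z t * X t).
  move=> GZ ZY; apply: rint_le rYX; last by move=> t; rewrite !normrM ler_wpM2r.
  by apply: measurable_funM => //; exact: gmeas_measurable GZ.
have rYp : rint P (fun t => Yp t * X t).
  apply: rp => // t; rewrite ger0_norm// /Yp.
  by case: (leP (Y t) 0) => // Y0; rewrite ler_norm.
have rYn : rint P (fun t => Yn t * X t).
  apply: rp => // t; rewrite ger0_norm// /Yn.
  by case: (leP (- Y t) 0) => // Y0; rewrite -normrN ler_norm.
transitivity (\int[P]_t (Yp t * X t - Yn t * X t)).
  apply: eq_Rintegral => t _; rewrite -mulrBl /Yp /Yn; congr (_ * _).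
  by case: (leP (Y t) 0) => Y0; case: (leP (- Y t) 0) => Y1; lra.
by rewrite RintB// !orth_mul_ge0// subrr.
Qed.

(* Truncating to the event where the weights [Y i] are small makes every product
   integrable, so neither [Y i * X i] nor their sum need be integrable globally. *)
Lemma Rint_ge0_of_orth (I : finType) (X Y : I -> T -> R) F (b : T -> bool) :
  (forall i, orth G (X i)) -> (forall i, gmeas G (Y i)) -> rint P F -> gbool G b ->
  (forall t, b t -> \sum_i Y i t * X i t <= F t) ->
  0 <= \int[P]_t ((b t)%:R * F t).
Proof.
move=> oX GY rF Gb YXF.
pose c n t := b t && (\sum_i `|Y i t| <= n%:R).
have Gc n : gbool G (c n).
  apply: gbool_and => //; apply: gbool_ler; last exact: measurable_cst.
  by apply: measurable_sum => i; apply: measurableT_comp => //; exact: GY.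
have cn n : 0 <= \int[P]_t ((c n t)%:R * F t).
  have rY i : rint P (fun t => (c n t)%:R * Y i t * X i t).
    have rX : rint P (X i) by case: (oX i).
    have GcY : gmeas G (fun t => (c n t)%:R * Y i t) by exact: gmeas_bool.
    apply: rint_le (rintZ n%:R rX).
      by apply: measurable_funM; [exact: gmeas_measurable GcY | exact: rint_measurable rX].
    move=> t; rewrite !normrM ler_wpM2r// [leRHS]ger0_norm//.
    case: (boolP (c n t)) => [/andP[_ Yn]|_]; last by rewrite normr0 mul0r.
    rewrite normr1 mul1r (le_trans _ Yn)// (bigD1 i)//= lerDl.
    by apply: sumr_ge0.
  have -> : 0 = \int[P]_t (\sum_i (c n t)%:R * Y i t * X i t).
    rewrite Rint_sum// big1// => i _.
    by apply: (orth_mul (oX i)) => //; exact: gmeas_bool.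
  apply: le_Rintegral => //; [exact: rint_sum|exact: rint_bool (Gc n) rF|].
  move=> t _; case: (boolP (c n t)) => [/andP[bt _]|_].
    by rewrite mul1r (le_trans _ (YXF t bt))//; apply: ler_sum => i _; rewrite mul1r.
  by rewrite mul0r big1// => i _; rewrite !mul0r.
have rcF n : rint P (fun t => (c n t)%:R * F t) by exact: rint_bool (Gc n) rF.
have rbF : rint P (fun t => (b t)%:R * F t) by exact: rint_bool Gb rF.
have mcF n : measurable_fun setT (fun t => ((c n t)%:R * F t)%:E).
  exact: measurable_int (rcF n).
have mbF : measurable_fun setT (fun t => ((b t)%:R * F t)%:E).
  exact: measurable_int rbF.
(* At a fixed point the truncation is inactive once n exceeds the sum of the absolute weights, so
   the sequence is eventually constant; [F] itself dominates. *)
have cvgc : {ae P, forall t, setT t ->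
    ((c n t)%:R * F t)%:E @[n --> \oo] --> ((b t)%:R * F t)%:E}.
  apply: aeW => t _; apply: cvg_near_cst.
  near=> n; rewrite /c (_ : _ <= _ = true) ?andbT//.
  by near: n; exact: nbhs_infty_ger.
have dom : {ae P, forall t n, setT t -> (`|((c n t)%:R * F t)%:E| <= `|(F t)%:E|)%E}.
  apply: aeW => t n _; rewrite lee_fin normrM.
  by case: (c n t); rewrite ?normr1 ?mul1r// normr0 mul0r.
have [_ _ +] := dominated_convergence measurableT mcF mbF cvgc (integrable_abse rF) dom.
rewrite (RintE rbF) => cvgF; rewrite -lee_fin; apply: (cvge_to_ge cvgF).
by near=> n; rewrite /= (RintE (rcF n)) lee_fin.
Unshelve. all: by end_near.
Qed.

End Orthogonality.

(** * Gaussian moments and independence *)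

Section NormalMoments.
Context {R : realType}.
Implicit Types m s x : R.

(** Doubling the standard deviation gains an exponential factor in [(x - m) ^+ 2], which absorbs any
    quadratic growth. Second moments then reduce to the integrability of a wider density. *)
Lemma normal_fun_sqr_le m s x : s != 0 ->
  (`|x| + 1) ^+ 2 * normal_fun m s x <=
    (16 * s ^+ 2 + 2 * (`|m| + 1) ^+ 2) * normal_fun m (2 * s) x.
Proof.
move=> s0; set K := 16 * _ + _.
have s2 : 0 < s ^+ 2 by rewrite exprn_even_gt0.
(* The difference of the two exponents: 1/2 - 1/8 = 3/8. Only [1 + u <= expR u] is used below. *)
pose u := 3 * (x - m) ^+ 2 / (8 * s ^+ 2).
have u0 : 0 <= u by apply: divr_ge0; apply: mulr_ge0 => //; exact: sqr_ge0.
have uE : (x - m) ^+ 2 = 8 / 3 * s ^+ 2 * u by rewrite /u; field.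
have -> : normal_fun m (2 * s) x = expR u * normal_fun m s x.
  by rewrite /normal_fun -expRD; congr expR; rewrite /u; field.
rewrite mulrA; apply: ler_wpM2r; first exact: normal_fun_ge0.
apply: (@le_trans _ _ (K * (1 + u))); last first.
  apply: ler_wpM2l; last exact: expR_ge1Dx.
  by apply: addr_ge0; apply: mulr_ge0 => //; exact: sqr_ge0.
have xm : `|x| <= `|x - m| + `|m| by rewrite -{1}(subrK m x) ler_normD.
have xm2 : `|x - m| ^+ 2 = 8 / 3 * s ^+ 2 * u by rewrite -uE real_normK ?num_real.
have := normr_ge0 x; have := normr_ge0 m; have := normr_ge0 (x - m).
move: xm xm2; rewrite /K; set a := `|x|; set b := `|m|; set c := `|x - m|.
move=> ac c2 c0 b0 a0.
have h1 : (a + 1) ^+ 2 <= (c + (b + 1)) ^+ 2 by rewrite lerXn2r ?nnegrE; lra.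
have h2 : (c + (b + 1)) ^+ 2 <= 2 * c ^+ 2 + 2 * (b + 1) ^+ 2.
  by have := sqr_ge0 (c - (b + 1)); nra.
have h3 : 0 <= s ^+ 2 * u by rewrite mulr_ge0// ltW.
have h4 : 0 <= (b + 1) ^+ 2 * u by rewrite mulr_ge0 ?sqr_ge0.
by nra.
Qed.

Lemma integrable_sqr_normal_pdf m s : s != 0 -> lebesgue_measure.-integrable setT
  (fun x : R => ((`|x| + 1) ^+ 2 * normal_pdf m s x)%:E).
Proof.
move=> s0; have s20 : 2 * s != 0 by rewrite mulf_neq0.
(* The constant of [normal_fun_sqr_le], corrected by the ratio of the normalising factors of the two
   densities. *)
pose C := (16 * s ^+ 2 + 2 * (`|m| + 1) ^+ 2) * normal_peak s / normal_peak (2 * s).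
have := integrableZl measurableT C (integrable_normal_pdf m (2 * s)).
apply: le_integrable => //.
  apply/measurable_EFinP; apply: measurable_funM; last exact: measurable_normal_pdf.
  by apply: measurable_funX; apply: measurable_funD.
move=> x _ /=; rewrite lee_fin.
rewrite !normal_pdfE// ler_normr; apply/orP; left.
rewrite ger0_norm ?mulr_ge0 ?sqr_ge0 ?normal_peak_ge0 ?normal_fun_ge0//.
have := normal_fun_sqr_le m x s0.
move=> /(ler_wpM2r (normal_peak_ge0 s)) h.
rewrite mulrCA [leLHS]mulrC (le_trans h)// /C.
have p0 : normal_peak (2 * s) != 0 by rewrite gt_eqF// normal_peak_gt0.
by rewrite [leRHS]mulrA divfK// mulrAC.
Qed.

(** The density enters through the probability of sets only. On the shell where [|x|] lies in [n,
    n+1), the integrand is at most (n+1)^2, and n+1 is at most [|x| + 1], which bounds each shell by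
    an integral against Lebesgue measure. *)
Lemma normal_sqr_lty m s : s != 0 -> (\int[normal_prob m s]_x (x ^+ 2)%:E < +oo)%E.
Proof.
move=> s0.
pose A (n : nat) : set R := [set x | n%:R <= `|x| < n.+1%:R].
have AE n : A n = (fun x : R => `|x|) @^-1` `[n%:R, n.+1%:R[%classic.
  by apply/seteqP; split=> x; rewrite /A /= in_itv.
have mA n : measurable (A n).
  by rewrite AE -[X in measurable X]setTI; exact: normr_measurable.
have tA : trivIset setT A.
  apply/trivIsetP => i j _ _ ij; apply/seteqP; split=> // x [/andP[a b] /andP[c e]].
  move: ij; rewrite neq_ltn => /orP[ij|ji].
    by have := le_lt_trans c b; rewrite ltr_nat ltnNge ij.
  by have := le_lt_trans a e; rewrite ltr_nat ltnNge ji.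
have UA : \bigcup_n A n = setT.
  apply/seteqP; split=> // x _; exists (Num.truncn `|x|) => //=.
  by apply: Num.Theory.truncn_itv.
have m2 : measurable_fun setT (fun x : R => (x ^+ 2)%:E).
  by apply/measurable_EFinP; exact: measurable_funX.
have mpdf c : measurable_fun setT (fun x : R => (c * normal_pdf m s x)%:E).
  by apply/measurable_EFinP; apply: measurable_funM => //; exact: measurable_normal_pdf.
have int2 := integrable_sqr_normal_pdf m s0.
have m3 := measurable_int _ int2.
apply: (@le_lt_trans _ _
  (\int[lebesgue_measure]_x ((`|x| + 1) ^+ 2 * normal_pdf m s x)%:E)%E); last first.
  have /integrableP[_] := int2; rewrite (_ : integral _ _ _ = integral lebesgue_measure setT
    (fun x : R => ((`|x| + 1) ^+ 2 * normal_pdf m s x)%:E))//.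
  apply: eq_integral => x _ /=.
  by rewrite ger0_norm// mulr_ge0 ?sqr_ge0 ?normal_pdf_ge0.
rewrite -UA !ge0_integral_bigcup//=; first last.
- by move=> x _; rewrite lee_fin sqr_ge0.
- by rewrite UA.
- by move=> x _; rewrite lee_fin mulr_ge0 ?sqr_ge0 ?normal_pdf_ge0.
- by rewrite UA.
apply: lee_nneseries => [n _ _|n _].
  by apply: integral_ge0 => x _; rewrite lee_fin sqr_ge0.
apply: (@le_trans _ _ ((n.+1%:R ^+ 2)%:E * normal_prob m s (A n))%E).
  rewrite -[leRHS](integral_cst (normal_prob m s) (mA n)).
  apply: ge0_le_integral => //=.
  - exact: mA.
  - by move=> x _; rewrite lee_fin sqr_ge0.
  - exact: measurable_funTS.
  - move=> x /andP[_ xn]; rewrite lee_fin -(real_normK (num_real x)).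
    by rewrite lerXn2r ?nnegrE// ltW.
rewrite /normal_prob -ge0_integralZl; first last.
- by rewrite lee_fin sqr_ge0.
- by move=> x _; rewrite lee_fin normal_pdf_ge0.
- by apply/measurable_funTS/measurable_EFinP; exact: measurable_normal_pdf.
- exact: mA.
apply: ge0_le_integral => //=.
- exact: mA.
- by move=> x _; rewrite -EFinM lee_fin mulr_ge0 ?sqr_ge0 ?normal_pdf_ge0.
- by apply: measurable_funTS; exact: mpdf.
- exact: measurable_funTS.
- move=> x /andP[nx _]; rewrite -EFinM lee_fin ler_wpM2r ?normal_pdf_ge0//.
  by rewrite lerXn2r ?nnegrE ?addr_ge0// -natr1 lerD2r.
Qed.
End NormalMoments.

(** * Second moments and means of Gaussian vectors *)

Section GaussianVectors.
Context {R : realType} {d : measure_display} {T : measurableType d}.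
Variable P : probability T R.

Lemma delta_dot q (X : 'cV[R]_q) i : ((delta_mx i 0 : 'cV[R]_q)^T *m X) 0 0 = X i 0.
Proof.
rewrite mxE (bigD1 i)//= big1 ?addr0; last first.
  by move=> j ji; rewrite !mxE (negbTE ji) mul0r.
by rewrite !mxE !eqxx mul1r.
Qed.

(** Projecting along a basis vector identifies the law of the coordinate as a Dirac mass or a normal
    law; the second moment is finite in either case. *)
Lemma gauss_vec_L2 q (X : T -> 'cV[R]_q) mu M i : rv_vec X -> gauss_vec P X mu M ->
  L2 P (fun t => X t i 0).
Proof.
move=> mX [pM gX]; have mXi := mX i; split=> //.
pose Rm := measurableTypeR R.
have mXi' : measurable_fun setT (fun t => X t i 0 : Rm) by exact: mXi.
pose Xi : {mfun T >-> Rm} := @mfun_Sub _ _ _ _ (fun t => X t i 0 : Rm) (mem_set mXi').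
apply/integrableP; split; first by apply/measurable_EFinP; exact: measurable_funX.
have m2 : measurable_fun (setT : set Rm) (fun x : Rm => ((x : R) ^+ 2)%:E).
  by apply/measurable_EFinP; exact: measurable_funX.
rewrite (_ : integral _ _ _ = integral (pushforward P Xi) setT
    (fun x : Rm => ((x : R) ^+ 2)%:E)); last first.
  rewrite ge0_integral_pushforward//=; last by move=> y _; rewrite lee_fin sqr_ge0.
  by apply: eq_integral => t _ /=; rewrite ger0_norm ?sqr_ge0.
have lawX B : measurable B -> P (Xi @^-1` B) = (if qf M (delta_mx i 0) == 0
    then (\1_B (mu i 0))%:E else normal_prob (mu i 0) (Num.sqrt (qf M (delta_mx i 0))) B).
  move=> mB; have := gX (delta_mx i 0) B mB; rewrite /= delta_dot => <-.
  by congr (P _); apply/seteqP; split=> t /=; rewrite delta_dot.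
have [s0|s0] := eqVneq (qf M (delta_mx i 0)) 0.
  rewrite (eq_measure_integral (\d_(mu i 0 : Rm) : {measure set _ -> \bar R})).
    by rewrite integral_dirac//= diracT mul1e ltry.
  by move=> A mA _; have := lawX A mA; rewrite s0 eqxx; exact.
have q0 : 0 < qf M (delta_mx i 0) by rewrite lt_neqAle eq_sym s0; case: pM => _ ->.
pose s := Num.sqrt (qf M (delta_mx i 0)).
have -> : (integral (pushforward P Xi) setT (fun x : Rm => ((x : R) ^+ 2)%:E) =
    \int[normal_prob (mu i 0%R) s]_x (x ^+ 2)%:E)%E.
  apply: eq_measure_integral => A mA _.
  by have := lawX A mA; rewrite (negbTE s0); exact.
by apply: normal_sqr_lty; rewrite gt_eqF// sqrtr_gt0.
Qed.

(* The laws of the projections along [a] and [- a] coincide when the mean vector is 0. *)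
Lemma gauss_vec_mean0 q (X : T -> 'cV[R]_q) M i : rv_vec X -> gauss_vec P X 0 M ->
  \int[P]_t (X t i 0) = 0.
Proof.
move=> mX gX; have rX := L2_rint (gauss_vec_L2 i mX gX).
have mXi := mX i; have mXN : measurable_fun setT (fun t => - X t i 0).
  exact: measurableT_comp.
pose Xp : {mfun T >-> R} := @mfun_Sub _ _ _ _ (fun t => X t i 0) (mem_set mXi).
pose Xn : {mfun T >-> R} := @mfun_Sub _ _ _ _ (fun t => - X t i 0) (mem_set mXN).
have sym B : measurable B -> P (Xp @^-1` B) = P (Xn @^-1` B).
  move=> mB; case: gX => _ gX.
  have := gX (delta_mx i 0) B mB; have := gX (- delta_mx i 0) B mB.
  have -> : qf M (- delta_mx i 0) = qf M (delta_mx i 0).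
    by rewrite /qf [trmx (- _)]raddfN/= mulNmx mulNmx mulmxN opprK.
  rewrite /= !mulmx0 => <-; congr (P _ = P _).
    by apply/seteqP; split=> t /=; rewrite delta_dot.
  by apply/seteqP; split=> t /=; rewrite [trmx (- _)]raddfN/= mulNmx mxE delta_dot.
have : \int[P]_t (X t i 0) = \int[P]_t (- X t i 0).
  rewrite /Rintegral; congr fine.
  have mid : measurable_fun setT (EFin : R -> \bar R) by exact: EFin_measurable.
  have := @integral_pushforward _ _ _ _ _ Xp mXi P setT EFin mid rX measurableT.
  have := @integral_pushforward _ _ _ _ _ Xn mXN P setT EFin mid (rintN rX) measurableT.
  rewrite !preimage_setT /= => <- <-.
  by apply: eq_measure_integral => A mA _; exact: sym.
rewrite -[X in _ = X -> _]/(\int[P]_t (- X t i 0)).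
have := RintB (rint_cst P 0) rX; under eq_Rintegral do rewrite sub0r.
move=> ->; rewrite Rintegral_cst// mul0r; lra.
Qed.
End GaussianVectors.

(** * Independence of one sigma-algebra from the join of others *)

Section Independence.
Context {R : realType} {d : measure_display} {T : measurableType d}.
Variable P : probability T R.

Lemma bigsetI_seqP (I : eqType) (J : seq I) (E : I -> set T) t :
  (\big[setI/setT]_(j <- J) E j) t <-> (forall j, j \in J -> E j t).
Proof.
elim: J => [|i J ih]; first by rewrite big_nil.
rewrite big_cons; split=> [[Ei /ih EJ] j|EJ].
  by rewrite inE => /orP[/eqP->//|]; exact: EJ.
split; first by apply: EJ; rewrite mem_head.
by apply/ih => j jJ; apply: EJ; rewrite inE jJ orbT.
Qed.

Variables (I : eqType) (valid : I -> Prop) (F : I -> set (set T)).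
Hypothesis FS : forall i, valid i -> sigma_algebra setT (F i).
Hypothesis Fm : forall i, valid i -> F i `<=` measurable.
Hypothesis indF : mutually_indep P valid F.

Let FT i : valid i -> F i setT.
Proof. by move=> /FS[F0 FC _]; rewrite -(setD0 setT); exact: FC. Qed.

Let FI i A B : valid i -> F i A -> F i B -> F i (A `&` B).
Proof.
move=> vi FA FB; rewrite -(measurable_g_measurableTypeE (FS vi)).
apply: (@measurableI _ (g_sigma_algebraType (F i))).
  by rewrite (measurable_g_measurableTypeE (FS vi)).
by rewrite (measurable_g_measurableTypeE (FS vi)).
Qed.

Definition joint_gen (S : I -> Prop) : set (set T) :=
  [set E | exists i, [/\ valid i, S i & F i E]].

Lemma joint_gen_measurable S : joint_gen S `<=` measurable.
Proof. by move=> E [i [vi _ FE]]; exact: Fm FE. Qed.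

(** Uniqueness of measures on a pi-system: finite intersections of events from the [F j] generate
    the join and are stable under intersection. On them the measures [P (E]&[D)] and [P E * P D], as
    functions of [E], agree by mutual independence. *)
Lemma indep_joint (S : I -> Prop) i E D : valid i -> ~ S i ->
  <<s joint_gen S >> E -> F i D -> P (E `&` D) = (P E * P D)%E.
Proof.
move=> vi nSi SE FD; have mD := Fm vi FD.
pose G : set (set T) := [set A | exists (J : seq I) (B : I -> set T),
  [/\ uniq J, forall j, j \in J -> [/\ valid j, S j & F j (B j)] &
      A = \big[setI/setT]_(j <- J) B j]].
have Gm : G `<=` measurable.
  move=> _ [J [B [_ JB ->]]]; elim: J JB => [|j J ih] JB; first by rewrite big_nil.
  rewrite big_cons; apply: measurableI.
    by have [vj _ Fj] := JB j (mem_head _ _); exact: Fm Fj.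
  by apply: ih => k kJ; apply: JB; rewrite inE kJ orbT.
have SG : joint_gen S `<=` G.
  move=> A [j [vj Sj FA]]; exists [:: j], (fun=> A); split=> //; last first.
    by rewrite big_seq1.
  by move=> k; rewrite inE => /eqP ->.
have GT : G setT by exists [::], (fun=> setT); rewrite big_nil; split.
have GI : setI_closed G.
  move=> _ _ [J1 [B1 [u1 h1 ->]]] [J2 [B2 [u2 h2 ->]]].
  pose B j := (if j \in J1 then B1 j else setT) `&` (if j \in J2 then B2 j else setT).
  exists (undup (J1 ++ J2)), B; split; first exact: undup_uniq.
    move=> j; rewrite mem_undup mem_cat => jJ.
    have [vj Sj] : valid j /\ S j.
      by case/orP: jJ => [/h1|/h2] [].
    split=> //; apply: FI => //.
      by case: ifP => [/h1[]//|_]; exact: FT.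
    by case: ifP => [/h2[]//|_]; exact: FT.
  apply/seteqP; split=> t.
    move=> [/bigsetI_seqP t1 /bigsetI_seqP t2]; apply/bigsetI_seqP => j _.
    by split; case: ifP => // jJ; [exact: t1|exact: t2].
  move=> /bigsetI_seqP tB; split; apply/bigsetI_seqP => j jJ.
    by have [] := tB j; rewrite ?mem_undup ?mem_cat ?jJ.
  by have [] := tB j; rewrite ?mem_undup ?mem_cat ?jJ ?orbT.
have PD0 : 0 <= fine (P D) by exact: fine_ge0.
have PDE : P D = (fine (P D))%:E by rewrite fineK// fin_num_measure.
have SE' : <<s G >> E.
  apply: smallest_sub SE; first exact: smallest_sigma_algebra.
  by move=> A /SG GA; exact: sub_sigma_algebra.
have -> : P (E `&` D) = mrestr P mD E by [].
rewrite (@g_sigma_algebra_measure_unique _ R T G Gm (fun=> setT) _ _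
  (mrestr P mD) (mscale (NngNum PD0) P) GI _ _ E SE')//.
- by rewrite /mscale muleC [in RHS]PDE.
- by rewrite bigcup_const//; exists 0%N.
- move=> _ [J [B [uJ h ->]]]; 
  rewrite -[LHS]/(P (_ `&` D)) -[RHS]/((fine (P D))%:E * P _)%E.
  (* Since [i] lies outside [J], one family serves twice: independence over [i :: J] splits off [D],
     and independence over [J] folds the remaining product back. *)
  pose B' j := if j == i then D else B j.
  have B'i : B' i = D by rewrite /B' eqxx.
  have iJ : i \notin J by apply/negP => /h[].
  have BB' : \big[setI/setT]_(j <- J) B j = \big[setI/setT]_(j <- J) B' j.
    apply: eq_big_seq => j jJ; rewrite /B'; case: eqP => // ji.
    by move: iJ; rewrite -ji jJ.
  have := indF (J := i :: J) (E := B').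
  rewrite !big_cons B'i setIC -BB' => ->.
  + rewrite EFinM; congr (_ * _)%E; rewrite BB'.
    rewrite (indF (J := J) (E := B'))// => j jJ; rewrite /B'.
    have [vj _ Fj] := h j jJ; split=> //; case: eqP => // ji.
    by move: iJ; rewrite -ji jJ.
  + by rewrite /= iJ.
  + move=> j; rewrite inE /B' => /orP[/eqP ->|jJ]; first by rewrite eqxx.
    have [vj _ Fj] := h j jJ; split=> //; case: eqP => // ji.
    by move: iJ; rewrite -ji jJ.
- move=> _; rewrite -[X in (X < _)%E]/(P (setT `&` D)) setTI PDE; exact: ltry.
Qed.

(* Independence says that [\1_E - P E] is orthogonal to [F i]; test it against [f]. *)
Lemma indep_orth (S : I -> Prop) i (f : T -> R) : valid i -> ~ S i ->
  (forall B : set R, measurable B -> F i (f @^-1` B)) -> rint P f ->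
  \int[P]_t f t = 0 -> orth P (joint_gen S) f.
Proof.
move=> vi nSi Ff rf f0; split=> // E SE.
have mE : measurable E.
  apply: smallest_sub SE; first exact: sigma_algebra_measurable.
  exact: joint_gen_measurable.
pose X t := \1_E t - fine (P E).
have r1 : rint P (\1_E : T -> R) by exact: integrable_indic.
have oX : orth P (F i) X.
  split; first by apply: rintB => //; exact: rint_cst.
  move=> D; rewrite (sigma_algebra_id (FS vi)) => FD; have mD := Fm vi FD.
  have rE := integrableS measurableT mD (@subsetT _ _) r1.
  have rc := integrableS measurableT mD (@subsetT _ _) (rint_cst P (fine (P E))).
  rewrite (integralB mD rE rc)/= integral_indic//.
  rewrite integral_cst//; have := indep_joint vi nSi SE FD; rewrite /= => ->.
  have PEf : P E \is a fin_num by exact: fin_num_measure.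
  by rewrite fineK// subee// fin_numM// fin_num_measure.
have Gf : gmeas (F i) f by apply: gmeasP => B mB; apply: sub_sigma_algebra; exact: Ff.
have r1f : rint P (fun t => \1_E t * f t) by exact: rint_indic.
have rcf : rint P (fun t => fine (P E) * f t) by exact: rintZ.
have fXE : (fun t => f t * X t) = (fun t => \1_E t * f t - fine (P E) * f t).
  by apply/funext => t; rewrite /X mulrBr mulrC [X in _ - X]mulrC.
have rfX : rint P (fun t => f t * X t) by rewrite fXE; exact: rintB.
have := orth_mul (Fm vi) oX Gf rfX; rewrite fXE RintB// RintegralZl// f0 mulr0 subr0.
rewrite Rint_indic => /eqP.
rewrite fine_eq0; first by move/eqP.
by apply: integrable_fin_num => //; exact: integrableS rf.
Qed.
End Independence.

(** * Riccati recursion *)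

Section BilinearForms.
Context {R : realType}.

Definition bf p q (x : 'cV[R]_p) (M : 'M[R]_(p, q)) (y : 'cV[R]_q) : R :=
  (x^T *m M *m y) 0 0.

Lemma qfE p (M : 'M[R]_p) x : qf M x = bf x M x. Proof. by []. Qed.

Lemma bfDl p q (x x' : 'cV[R]_p) (M : 'M[R]_(p, q)) y :
  bf (x + x') M y = bf x M y + bf x' M y.
Proof. by rewrite /bf linearD/= !mulmxDl mxE. Qed.

Lemma bfDr p q (x : 'cV[R]_p) (M : 'M[R]_(p, q)) y y' :
  bf x M (y + y') = bf x M y + bf x M y'.
Proof. by rewrite /bf mulmxDr mxE. Qed.

Lemma bfNl p q (x : 'cV[R]_p) (M : 'M[R]_(p, q)) y : bf (- x) M y = - bf x M y.
Proof. by rewrite /bf [trmx (- _)]raddfN/= !mulNmx mxE. Qed.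

Lemma bfNr p q (x : 'cV[R]_p) (M : 'M[R]_(p, q)) y : bf x M (- y) = - bf x M y.
Proof. by rewrite /bf mulmxN mxE. Qed.

Lemma bfZl p q a (x : 'cV[R]_p) (M : 'M[R]_(p, q)) y : bf (a *: x) M y = a * bf x M y.
Proof. by rewrite /bf [trmx (_ *: _)]linearZ/= -!scalemxAl mxE. Qed.

Lemma bfZr p q a (x : 'cV[R]_p) (M : 'M[R]_(p, q)) y : bf x M (a *: y) = a * bf x M y.
Proof. by rewrite /bf -scalemxAr mxE. Qed.

Lemma bfDm p q (x : 'cV[R]_p) (M M' : 'M[R]_(p, q)) y :
  bf x (M + M') y = bf x M y + bf x M' y.
Proof. by rewrite /bf mulmxDr mulmxDl mxE. Qed.

Lemma bfNm p q (x : 'cV[R]_p) (M : 'M[R]_(p, q)) y : bf x (- M) y = - bf x M y.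
Proof. by rewrite /bf mulmxN mulNmx mxE. Qed.

Lemma bf_mulr p q r (x : 'cV[R]_p) (M : 'M[R]_(p, q)) (N : 'M[R]_(q, r)) y :
  bf x M (N *m y) = bf x (M *m N) y.
Proof. by rewrite /bf !mulmxA. Qed.

Lemma bf_mull p q r (x : 'cV[R]_r) (M : 'M[R]_(p, q)) (N : 'M[R]_(p, r)) y :
  bf (N *m x) M y = bf x (N^T *m M) y.
Proof. by rewrite /bf trmx_mul !mulmxA. Qed.

Lemma bf_tr p q (x : 'cV[R]_p) (M : 'M[R]_(p, q)) y : bf x M y = bf y M^T x.
Proof.
rewrite /bf; have -> : y^T *m M^T *m x = (x^T *m M *m y)^T.
  by rewrite !trmx_mul trmxK mulmxA.
by rewrite [RHS]mxE.
Qed.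

(** Coordinate products are the shape to which [orth_mul] and [L2_mul_rint] apply. *)
Lemma bf_sum p q (x : 'cV[R]_p) (M : 'M[R]_(p, q)) y :
  bf x M y = \sum_i (M^T *m x) i 0 * y i 0.
Proof.
rewrite /bf mxE; apply: eq_bigr => i _; congr (_ * _).
by rewrite -[in RHS](trmxK x) -trmx_mul [RHS]mxE.
Qed.

End BilinearForms.

Section CompletionOfSquares.
Context {R : realType} {n m : nat}.

Lemma pd_unitmx q (M : 'M[R]_q) : pd M -> M \in unitmx.
Proof.
move=> [sM pM]; rewrite -row_free_unit -kermx_eq0.
apply/negPn/negP => /rowV0Pn[v /sub_kermxP vM v0].
have : 0 < qf M v^T by apply: pM; rewrite -(inj_eq trmx_inj) trmxK trmx0.
by rewrite /qf trmxK vM mul0mx mxE ltxx.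
Qed.

Variables (A : 'M[R]_n) (B : 'M[R]_(n, m)) (S Q : 'M[R]_n) (Ru : 'M[R]_m).
Hypotheses (pS : psd S) (pQ : psd Q) (pRu : pd Ru).

Let D := B^T *m S *m B + Ru.
Let L := invmx D *m B^T *m S *m A.
Let Gam0 := A^T *m S *m B *m invmx D *m B^T *m S *m A.
Let S' := Q + A^T *m S *m A - Gam0.

Let pdD : pd D.
Proof.
case: pS pRu => sS p_S [sR pR]; split.
  by rewrite /D linearD/= !trmx_mul trmxK sS sR mulmxA.
move=> z z0; rewrite /D qfE bfDm; apply: ltr_wpDl; last exact: pR.
by have := p_S (B *m z); rewrite qfE bf_mull bf_mulr.
Qed.

Let DL : D *m L = B^T *m S *m A.
Proof. by rewrite /L !mulmxA mulmxV ?mul1mx// pd_unitmx. Qed.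

Let trD : D^T = D. Proof. by case: pdD. Qed.

Let LD : L^T *m D = A^T *m S *m B.
Proof.
case: pS => sS _; apply: trmx_inj; rewrite trmx_mul trmxK trD DL.
by rewrite !trmx_mul trmxK sS mulmxA.
Qed.

Lemma qf_gain e : qf D (L *m e) = qf Gam0 e.
Proof.
rewrite !qfE bf_mull bf_mulr LD /L /Gam0.
by rewrite !mulmxA.
Qed.

(** The input [- (L *m x)] minimises the left side, because [D *m L] is the coefficient
    [B^T *m S *m A] of its cross term; [S'] gives the minimum. *)
Lemma complete_square x u :
  qf Q x + qf Ru u + qf S (A *m x + B *m u) = qf S' x + qf D (u + L *m x).
Proof.
rewrite !qfE !bfDl !bfDr !bf_mull !bf_mulr LD DL.
have -> : A^T *m S *m B *m L = Gam0 by rewrite /L /Gam0 !mulmxA.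
rewrite /S' /D !bfDm !bfNm; ring.
Qed.

(** At the minimising input the square vanishes, and the form of [S'] becomes a sum of three
    nonnegative costs. *)
Lemma psd_riccati : psd S'.
Proof.
case: pS pQ pRu => sS p_S [sQ p_Q] [sR pR]; split.
  have trI : (invmx D)^T = invmx D by rewrite trmx_inv trD.
  by rewrite /S' /Gam0 !(linearD, linearN)/= !trmx_mul !trmxK sS sQ trI !mulmxA.
move=> z; have := complete_square z (- (L *m z)).
rewrite addNr [qf D 0]qfE /bf mulmx0 mxE addr0 => <-.
rewrite !addr_ge0 ?p_Q ?p_S//.
have [->|nz] := eqVneq (- (L *m z)) 0; first by rewrite qfE /bf mulmx0 mxE.
by rewrite ltW// pR.
Qed.

(* Only the error x - xh enters the excess cost of the certainty-equivalent input. *)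
Lemma one_step_cost x xh w :
  qf Q x + qf Ru (- (L *m xh)) + qf S (A *m x + B *m (- (L *m xh)) + w) =
  qf S' x + qf Gam0 (x - xh) + qf S w + 2 * bf (A *m x + B *m (- (L *m xh))) S w.
Proof.
have := complete_square x (- (L *m xh)).
rewrite addrC -[_ + L *m x]addrC -mulmxBr qf_gain => h.
rewrite [qf S (_ + w)]qfE bfDl !(bfDr _ _ _ w) -!qfE.
have -> : bf w S (A *m x + B *m - (L *m xh)) = bf (A *m x + B *m - (L *m xh)) S w.
  by case: pS => sS _; rewrite bf_tr sS.
by rewrite -h; ring.
Qed.

End CompletionOfSquares.

Section RiccatiFacts.
Context {R : realType} {n m : nat} (sys : lqsys R n m).
Local Notation N := (horizon sys).
Hypothesis pQ : forall k, (k <= N.+1)%N -> psd (Qm sys k).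
Hypothesis pR : forall k, (k <= N)%N -> pd (Rm sys k).

Lemma RicS k : (k <= N)%N ->
  Ric sys k = Qm sys k + (Am sys k)^T *m Ric sys k.+1 *m Am sys k - Gam sys k.
Proof.
move=> kN; rewrite /Gam kN /Ric subSS subSn//=.
by rewrite subKn.
Qed.

Lemma psd_Ric k : (k <= N.+1)%N -> psd (Ric sys k).
Proof.
rewrite /Ric => _; set j := (N.+1 - k)%N.
have : (j <= N.+1)%N by exact: leq_subr.
elim: j => [_|j ih jN] /=; first exact: pQ.
apply: psd_riccati; first exact: ih (ltnW jN).
  by apply: pQ; rewrite (leq_trans (leq_subr _ _)).
by apply: pR; exact: leq_subr.
Qed.

Lemma riccati_step k (x xh w : 'cV[R]_n) : (k <= N)%N ->
  qf (Qm sys k) x + qf (Rm sys k) (- (Lgain sys k *m xh)) +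
    qf (Ric sys k.+1) (Am sys k *m x + Bm sys k *m (- (Lgain sys k *m xh)) + w) =
  qf (Ric sys k) x + qf (Gam sys k) (x - xh) + qf (Ric sys k.+1) w +
    2 * bf (Am sys k *m x + Bm sys k *m (- (Lgain sys k *m xh))) (Ric sys k.+1) w.
Proof.
move=> kN; rewrite (RicS kN) /Gam kN.
exact: one_step_cost (psd_Ric _) (pR kN) _ _ _.
Qed.

(** Solving the Riccati equation for [Gam sys k] expresses it by symmetric matrices without an
    inverse. *)
Lemma Gam_tr k : (k <= N)%N -> (Gam sys k)^T = Gam sys k.
Proof.
move=> kN; have [sk _] := psd_Ric (leqW kN); have [sQ _] := pQ (leqW kN).
have [sk1 _] := psd_Ric (kN : (k.+1 <= N.+1)%N).
have -> : Gam sys k = Qm sys k + (Am sys k)^T *m Ric sys k.+1 *m Am sys k - Ric sys k.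
  by rewrite (RicS kN); rewrite opprB addrCA subrr addr0.
by rewrite !(linearD, linearN)/= !trmx_mul trmxK sk sQ sk1 mulmxA.
Qed.
End RiccatiFacts.

(** * Rollout *)

Section RandomMatrices.
Context {R : realType} {d : measure_display} {T : measurableType d}.
Variable P : probability T R.

Definition vgm (G : set (set T)) p q (X : T -> 'M[R]_(p, q)) : Prop :=
  forall i j, gmeas G (fun t => X t i j).

Definition vL2 p q (X : T -> 'M[R]_(p, q)) : Prop :=
  forall i j, L2 P (fun t => X t i j).

Lemma vgm_sub G H p q (X : T -> 'M[R]_(p, q)) : G `<=` <<s H >> -> vgm G X -> vgm H X.
Proof. by move=> GH GX i j; exact: gmeas_sub (GX i j). Qed.

Lemma vgm_cst G p q (M : 'M[R]_(p, q)) : vgm G (fun=> M).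
Proof. by move=> i j; exact: measurable_cst. Qed.

Lemma vgmD G p q (X Y : T -> 'M[R]_(p, q)) : vgm G X -> vgm G Y ->
  vgm G (fun t => X t + Y t).
Proof.
move=> GX GY i j; have := measurable_funD (GX i j) (GY i j); congr measurable_fun.
by apply/funext => t; rewrite mxE.
Qed.

Lemma vgmN G p q (X : T -> 'M[R]_(p, q)) : vgm G X -> vgm G (fun t => - X t).
Proof.
move=> GX i j; have : gmeas G (fun t => - X t i j) by apply: measurableT_comp => //; exact: GX.
by congr measurable_fun; apply/funext => t /=; rewrite mxE.
Qed.

Lemma vgmB G p q (X Y : T -> 'M[R]_(p, q)) : vgm G X -> vgm G Y ->
  vgm G (fun t => X t - Y t).
Proof. by move=> GX GY; apply: vgmD => //; exact: vgmN. Qed.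

Lemma vgm_mulmx G p q r (X : T -> 'M[R]_(p, q)) (Y : T -> 'M[R]_(q, r)) :
  vgm G X -> vgm G Y -> vgm G (fun t => X t *m Y t).
Proof.
move=> GX GY i j.
have : gmeas G (fun t => \sum_k X t i k * Y t k j).
  by apply: measurable_sum => k; apply: measurable_funM; [exact: GX|exact: GY].
by congr measurable_fun; apply/funext => t; rewrite mxE.
Qed.

Lemma vgm_mulmxl G p q r (M : 'M[R]_(p, q)) (Y : T -> 'M[R]_(q, r)) :
  vgm G Y -> vgm G (fun t => M *m Y t).
Proof. by apply: vgm_mulmx; exact: vgm_cst. Qed.

Lemma vgm_tr G p q (X : T -> 'M[R]_(p, q)) : vgm G X -> vgm G (fun t => (X t)^T).
Proof.
move=> GX i j; have := GX j i; congr measurable_fun.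
by apply/funext => t; rewrite mxE.
Qed.

Lemma vgm_bool G p q (b : T -> bool) (X : T -> 'M[R]_(p, q)) : gbool G b -> vgm G X ->
  vgm G (fun t => ((b t)%:R : R) *: X t).
Proof.
move=> Gb GX i j; have := gmeas_bool Gb (GX i j); congr measurable_fun.
by apply/funext => t; rewrite mxE.
Qed.

Lemma vL2D p q (X Y : T -> 'M[R]_(p, q)) : vL2 X -> vL2 Y -> vL2 (fun t => X t + Y t).
Proof.
move=> LX LY i j; have := L2D (LX i j) (LY i j); congr L2.
by apply/funext => t; rewrite mxE.
Qed.

Lemma vL2N p q (X : T -> 'M[R]_(p, q)) : vL2 X -> vL2 (fun t => - X t).
Proof.
move=> LX i j; have := L2N (LX i j); congr L2.
by apply/funext => t; rewrite mxE.
Qed.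

Lemma vL2B p q (X Y : T -> 'M[R]_(p, q)) : vL2 X -> vL2 Y -> vL2 (fun t => X t - Y t).
Proof. by move=> LX LY; apply: vL2D => //; exact: vL2N. Qed.

Lemma vL2_cst p q (M : 'M[R]_(p, q)) : vL2 (fun=> M).
Proof. by move=> i j; exact: L2_cst. Qed.

(** Meant for the Kalman gain, which is random because past triggers determine the covariance. *)
Lemma vL2_mulmx_bounded c p q r (K : T -> 'M[R]_(p, q)) (X : T -> 'M[R]_(q, r)) :
  (forall i j, measurable_fun setT (fun t => K t i j)) ->
  (forall t i j, `|K t i j| <= c) -> vL2 X -> vL2 (fun t => K t *m X t).
Proof.
move=> mK Kc LX i j.
have : L2 P (fun t => \sum_k K t i k * X t k j).
  by apply: L2_sum => k; apply: (L2_bounded_mul (c := c)).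
by congr L2; apply/funext => t; rewrite mxE.
Qed.

Lemma vL2_mulmxl p q r (M : 'M[R]_(p, q)) (X : T -> 'M[R]_(q, r)) :
  vL2 X -> vL2 (fun t => M *m X t).
Proof.
move=> LX i j.
have : L2 P (fun t => \sum_k M i k * X t k j).
  by apply: L2_sum => k; exact: L2Z.
by congr L2; apply/funext => t; rewrite mxE.
Qed.

Lemma vL2_bool G p q (b : T -> bool) (X : T -> 'M[R]_(p, q)) : G `<=` measurable ->
  gbool G b -> vL2 X -> vL2 (fun t => ((b t)%:R : R) *: X t).
Proof.
move=> Gm Gb LX i j; apply: L2_le (LX i j).
  have mX : gmeas (@measurable d T) (fun t => X t i j).
    apply: gmeasP => B mB; apply: sub_sigma_algebra.
    by rewrite -[X in measurable X]setTI; case: (LX i j) => mX _; exact: mX.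
  have : gmeas (@measurable d T) (fun t => (b t)%:R * X t i j).
    apply: gmeas_bool => //; apply: gbool_sub Gb => E GE.
    by apply: sub_sigma_algebra; exact: Gm.
  move=> /gmeas_measurable => /(_ (@subset_refl _ _)); congr measurable_fun.
  by apply/funext => t; rewrite mxE.
by move=> t; rewrite mxE; case: (b t); rewrite ?mul1r// mul0r normr0.
Qed.

Lemma bf_rint p q (X : T -> 'cV[R]_p) (M : 'M[R]_(p, q)) (Y : T -> 'cV[R]_q) :
  vL2 X -> vL2 Y -> rint P (fun t => bf (X t) M (Y t)).
Proof.
move=> LX LY; have LM := vL2_mulmxl M^T LX.
have : rint P (fun t => \sum_i (M^T *m X t) i 0 * Y t i 0).
  by apply: rint_sum => i; apply: L2_mul_rint; [exact: LM|exact: LY].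
by congr rint; apply/funext => t; rewrite bf_sum.
Qed.

Lemma qf_rint p (M : 'M[R]_p) (X : T -> 'cV[R]_p) : vL2 X -> rint P (fun t => qf M (X t)).
Proof. by move=> LX; exact: bf_rint. Qed.

End RandomMatrices.

(** * Improvement of a deterministic schedule by the value of information *)

Section Rollout.
Context {R : realType} {d : measure_display} {T : measurableType d}.
Variable P : probability T R.
Context {n m : nat} (sys : lqsys R n m).
Local Notation N := (horizon sys).
Local Notation A := (Am sys).
Local Notation B := (Bm sys).
Local Notation L := (Lgain sys).
Hypothesis pQ : forall k, (k <= N.+1)%N -> psd (Qm sys k).
Hypothesis pR : forall k, (k <= N)%N -> pd (Rm sys k).

Variables (St : Type) (step : nat -> T -> St -> bool -> St).
Variables (xof xhof : St -> 'cV[R]_n) (w : nat -> T -> 'cV[R]_n).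
Variables (g : nat -> T -> St -> 'cV[R]_n) (s0 : T -> St).
Hypothesis step_x : forall k t s b, xof (step k t s b) =
  A k *m xof s + B k *m (- (L k *m xhof s)) + w k t.
Hypothesis step_xh : forall k t s b, xhof (step k t s b) =
  A k *m xhof s + B k *m (- (L k *m xhof s)) + (b%:R : R) *: g k t s.

Local Notation policy := (nat -> T -> St -> bool).

Fixpoint run (trig : policy) (k0 : nat) (s : T -> St) (j : nat) (t : T) : St :=
  match j with
  | 0 => s t
  | j'.+1 => let st := run trig k0 s j' t in
             step (k0 + j') t st (trig (k0 + j')%N t st)
  end.

Definition loop (trig : policy) (k : nat) (t : T) : St := run trig 0 s0 k t.

Definition fires (trig : policy) (k : nat) (t : T) : bool := trig k t (loop trig k t).

Definition err (trig : policy) (k : nat) (t : T) : 'cV[R]_n :=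
  xof (loop trig k t) - xhof (loop trig k t).

Definition total_cost (trig : policy) (t : T) : R :=
  let s k := loop trig k t in
  qf (Qm sys N.+1) (xof (s N.+1)) +
  \sum_(k < N.+1) (qf (Qm sys k) (xof (s k)) + qf (Rm sys k) (- (L k *m xhof (s k)))
                   + theta sys k * ((trig k t (s k))%:R : R)).

Definition cost_to_go (trig : policy) (dbar : nat -> bool) (k : nat) (dl : bool) (t : T) : R :=
  let s' j := run (fun k' _ _ => if k' == k then dl else dbar k') k (loop trig k) j t in
  \sum_(k.+1 <= j < N.+1)
     (theta sys j * ((dbar j)%:R : R)
      + qf (Gam sys j.+1) (xof (s' (j.+1 - k)%N) - xhof (s' (j.+1 - k)%N))).

Definition stage (trig : policy) (j : nat) (t : T) : R :=
  theta sys j * ((fires trig j t)%:R : R) + qf (Gam sys j.+1) (err trig j.+1 t).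

Definition reduced_cost (trig : policy) (t : T) : R := \sum_(j < N.+1) stage trig j t.

Lemma loopS trig k t :
  loop trig k.+1 t = step k t (loop trig k t) (fires trig k t).
Proof. by rewrite /fires /loop /= add0n. Qed.

(** The rules are compared only on states that the first loop visits; this lets a rule be replaced,
    at one sample point, by the decisions it takes there. *)
Lemma loop_ext trig1 trig2 t k :
  (forall j, (j < k)%N -> fires trig1 j t = trig2 j t (loop trig1 j t)) ->
  loop trig1 k t = loop trig2 k t.
Proof.
elim: k => [//|k ih] h; rewrite !loopS h// /fires ih// => j jk.
by apply: h; exact: ltnW.
Qed.

Lemma reduced_cost_ext trig1 trig2 t :
  (forall j, (j <= N)%N -> fires trig1 j t = trig2 j t (loop trig1 j t)) ->
  reduced_cost trig1 t = reduced_cost trig2 t.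
Proof.
move=> h; have hc k : (k <= N.+1)%N -> loop trig1 k t = loop trig2 k t.
  by move=> kN; apply: loop_ext => j jk; apply: h; rewrite -ltnS (leq_trans jk).
apply: eq_bigr => j _; have jN : (j <= N)%N by rewrite -ltnS.
by rewrite /stage /err hc// h// /fires (hc j)// leqW.
Qed.

Definition cross (trig : policy) (k : nat) (t : T) : R :=
  bf (A k *m xof (loop trig k t) + B k *m (- (L k *m xhof (loop trig k t))))
     (Ric sys k.+1) (w k t).

Definition noise_cost (t : T) : R :=
  qf (Ric sys 0) (xof (s0 t)) + qf (Gam sys 0) (xof (s0 t) - xhof (s0 t)) +
  \sum_(k < N.+1) qf (Ric sys k.+1) (w k t).

Lemma total_costE trig t : total_cost trig t =
  noise_cost t + reduced_cost trig t + 2 * \sum_(k < N.+1) cross trig k t.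
Proof.
(* The value function of the fully observed problem; adding the one-step identities makes it
   telescope. *)
pose V k := qf (Ric sys k) (xof (loop trig k t)).
have tele K : (K <= N.+1)%N -> V K + \sum_(k < K) (qf (Qm sys k) (xof (loop trig k t)) +
      qf (Rm sys k) (- (L k *m xhof (loop trig k t)))) =
    V 0%N + \sum_(k < K) (qf (Gam sys k) (err trig k t) + qf (Ric sys k.+1) (w k t) +
      2 * cross trig k t).
  elim: K => [|K ih] KN; first by rewrite !big_ord0.
  rewrite !big_ord_recr/= [RHS]addrA -ih 1?ltnW//.
  rewrite /V {1}loopS step_x.
  have := riccati_step pQ pR (xof (loop trig K t)) (xhof (loop trig K t)) (w K t) KN.
  by rewrite -/(err trig K t) -/(cross trig K t); lra.
(* Index shift: the error weighted at time k+1 is the one that delta_k affects. The new last term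
   vanishes as Gamma_{N+1} = 0, and the term at 0 involves the initial state alone. *)
have Gl : \sum_(k < N.+1) qf (Gam sys k) (err trig k t) =
    qf (Gam sys 0) (err trig 0 t) + \sum_(k < N.+1) qf (Gam sys k.+1) (err trig k.+1 t).
  rewrite big_ord_recl/=; congr (_ + _); rewrite [RHS]big_ord_recr/=.
  have GN : Gam sys N.+1 = 0 by rewrite /Gam ltnn.
  by rewrite GN [qf 0 _]/qf mulmx0 mul0mx mxE addr0.
have QN : Qm sys N.+1 = Ric sys N.+1 by rewrite /Ric subnn.
rewrite /total_cost /= QN big_split/= addrA -/(V N.+1) tele// !big_split/= Gl.
rewrite /noise_cost /reduced_cost /stage big_split/= /fires mulr_sumr /V /err /loop /=.
by lra.
Qed.

Variables (H G : nat -> set (set T)).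
Hypothesis Hm : forall k, H k `<=` measurable.
Hypothesis GH : forall k, (k <= N)%N -> G k `<=` <<s H k >>.
Hypothesis s0L2 : vL2 P (fun t => xof (s0 t)) /\ vL2 P (fun t => xhof (s0 t)).
Hypothesis wL2 : forall k, (k <= N)%N -> vL2 P (w k).
Hypothesis w_orth : forall k, (k <= N)%N -> forall i, orth P (H k) (fun t => w k t i 0).

(** Measurability is asked with respect to past noise, a filtration that does not change with the
    policy, so that all hybrids satisfy it at once. *)
Definition adapted (trig : policy) : Prop :=
  forall k, (k <= N)%N -> gbool (H k) (fires trig k).

Hypothesis regular : forall trig, adapted trig -> forall k, (k <= N.+1)%N ->
  [/\ vgm (H k) (fun t => xof (loop trig k t)), vL2 P (fun t => xof (loop trig k t)),
      vgm (H k) (fun t => xhof (loop trig k t)) & vL2 P (fun t => xhof (loop trig k t))].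

Lemma err_L2 trig k : adapted trig -> (k <= N.+1)%N -> vL2 P (err trig k).
Proof. by move=> /regular h /h[_ ? _ ?]; exact: vL2B. Qed.

Lemma rint_fires trig k c : adapted trig -> (k <= N)%N ->
  rint P (fun t => c * (fires trig k t)%:R).
Proof.
move=> ad kN; have := rint_bool (@Hm k) (ad k kN) (rint_cst P c); congr rint.
by apply/funext => t; rewrite mulrC.
Qed.

Lemma rint_stage trig k : adapted trig -> (k <= N)%N -> rint P (stage trig k).
Proof.
by move=> ad kN; apply: rintD; [exact: rint_fires|apply: qf_rint; exact: err_L2].
Qed.

Lemma rint_reduced_cost trig : adapted trig -> rint P (reduced_cost trig).
Proof. by move=> ad; apply: rint_sum => j; apply: rint_stage => //; rewrite -ltnS. Qed.

Lemma rint_noise_cost : rint P noise_cost.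
Proof.
case: s0L2 => Lx Lxh; apply: rintD; first apply: rintD.
- exact: qf_rint.
- by apply: qf_rint; exact: vL2B.
- by apply: rint_sum => k; apply: qf_rint; apply: wL2; rewrite -ltnS.
Qed.

Lemma input_L2 trig k : adapted trig -> (k <= N)%N ->
  vL2 P (fun t => A k *m xof (loop trig k t) + B k *m (- (L k *m xhof (loop trig k t)))).
Proof.
move=> ad kN; have [_ Lx _ Lxh] := regular ad (leqW kN).
by apply: vL2D; apply: vL2_mulmxl => //; apply: vL2N; exact: vL2_mulmxl.
Qed.

Lemma rint_cross trig k : adapted trig -> (k <= N)%N -> rint P (cross trig k).
Proof. by move=> ad kN; apply: bf_rint; [exact: input_L2|exact: wL2]. Qed.

Lemma Rint_cross trig k : adapted trig -> (k <= N)%N -> \int[P]_t cross trig k t = 0.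
Proof.
move=> ad kN; have LU := input_L2 ad kN.
have [Gx _ Gxh _] := regular ad (leqW kN).
under eq_Rintegral do rewrite /cross bf_sum.
have LS := vL2_mulmxl (Ric sys k.+1)^T LU.
have rS (i : 'I_n) : rint P (fun t => ((Ric sys k.+1)^T *m (A k *m xof (loop trig k t) +
    B k *m (- (L k *m xhof (loop trig k t))))) i 0 * w k t i 0).
  by apply: L2_mul_rint; [exact: LS|exact: wL2].
rewrite Rint_sum// big1// => i _.
apply: (orth_mul (@Hm k) (w_orth kN i)) => //.
have GS : vgm (H k) (fun t => (Ric sys k.+1)^T *m (A k *m xof (loop trig k t) +
    B k *m (- (L k *m xhof (loop trig k t))))).
  apply: vgm_mulmxl; apply: vgmD; apply: vgm_mulmxl => //; apply: vgmN.
  exact: vgm_mulmxl.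
exact: GS.
Qed.

Lemma total_cost_int trig : adapted trig -> (\int[P]_t (total_cost trig t)%:E =
  (\int[P]_t noise_cost t + \int[P]_t reduced_cost trig t)%:E)%E.
Proof.
move=> ad; have rN := rint_noise_cost; have rc := rint_reduced_cost ad.
have kN (k : 'I_N.+1) : (k <= N)%N by rewrite -ltnS.
have rX (k : 'I_N.+1) : rint P (cross trig k) by exact: rint_cross.
have rS : rint P (fun t => \sum_(k < N.+1) cross trig k t) by exact: rint_sum.
have tE : total_cost trig =
    (fun t => noise_cost t + reduced_cost trig t + 2 * \sum_(k < N.+1) cross trig k t).
  by apply/funext => t; rewrite total_costE.
have r2 := rintZ 2 rS; have r1 := rintD rN rc.
have rT : rint P (total_cost trig) by rewrite tE; exact: rintD.
have X0 : \int[P]_t (\sum_(k < N.+1) cross trig k t) = 0.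
  by rewrite Rint_sum// big1// => k _; exact: Rint_cross.
by rewrite RintE// tE RintD// RintD// RintegralZl// X0 mulr0 addr0.
Qed.

Variables (tau : policy) (dbar : nat -> bool).
Variables (xc : nat -> T -> 'cV[R]_n) (Z0 Z1 : nat -> T -> R).
Hypothesis tauG : forall k, (k <= N)%N -> gbool (G k) (fires tau k).
Hypothesis gG : forall k, (k <= N)%N -> vgm (G k) (fun t => g k t (loop tau k t)).
Hypothesis xc_cond : forall k, (k <= N)%N -> forall i,
  orth P (G k) (fun t => xof (loop tau k t) i 0 - xc k t i 0).
Hypothesis Z0_cond : forall k, (k <= N)%N ->
  cond_exp_of P <<s G k >> (cost_to_go tau dbar k false) (Z0 k).
Hypothesis Z1_cond : forall k, (k <= N)%N ->
  cond_exp_of P <<s G k >> (cost_to_go tau dbar k true) (Z1 k).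

(** Replacing an error [e] by [e - gk] lowers its quadratic form by [bf gk Gam (2 *: e - gk)]. Here
    the unknown state is replaced by its estimate [xc] and the noise is dropped. For [gk = A e] and
    [xc] equal to the state, this collapses to the perfect-information formula. *)
Definition voi (k : nat) (t : T) : R :=
  let gk := g k t (loop tau k t) in
  bf gk (Gam sys k.+1) (2 *: (A k *m (xc k t - xhof (loop tau k t))) - gk)
    - theta sys k + (Z0 k t - Z1 k t).

Hypothesis tau_voi : forall k t, (k <= N)%N -> fires tau k t = (0 <= voi k t).

(** Keeping the decision [dl] at time [k] free lets the same family describe two consecutive hybrids
    and the alternatives compared by the value of information. *)
Definition hyb (k : nat) (dl : bool) : policy := fun k' t s =>
  if (k' < k)%N then tau k' t s else if k' == k then dl else dbar k'.

Lemma loop_hyb k dl j t : (j <= k)%N -> loop (hyb k dl) j t = loop tau j t.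
Proof.
move=> jk; apply/esym; apply: loop_ext => i ij.
by rewrite /hyb (leq_trans ij jk).
Qed.

Lemma fires_hyb k dl j t : fires (hyb k dl) j t =
  if (j < k)%N then fires tau j t else if j == k then dl else dbar j.
Proof. by rewrite /fires {1}/hyb; case: ltnP => // jk; rewrite loop_hyb 1?ltnW. Qed.

Lemma adapted_tau : adapted tau.
Proof. by move=> k kN; apply: gbool_sub (tauG kN); exact: GH. Qed.

Lemma adapted_dbar : adapted (fun k _ _ => dbar k).
Proof. by move=> k kN; exact: gbool_cst. Qed.

Lemma adapted_hyb k dl : adapted (hyb k dl).
Proof.
move=> j jN; rewrite (_ : fires _ _ = fun t =>
    if (j < k)%N then fires tau j t else if j == k then dl else dbar j); last first.
  by apply/funext => t; rewrite fires_hyb.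
by case: (j < k)%N; [exact: (adapted_tau jN)|exact: gbool_cst].
Qed.

(** The prediction restarts at time [k] from the state of the [tau] loop, which is the state the
    hybrid has reached. Hence [cost_to_go] is the tail of the cost of a hybrid. *)
Lemma run_hyb k dl i t :
  run (fun k' _ _ => if k' == k then dl else dbar k') k (loop tau k) i t =
  loop (hyb k dl) (k + i) t.
Proof.
elim: i => [|i ih]; first by rewrite addn0 loop_hyb.
rewrite addnS loopS /= ih fires_hyb ltnNge leq_addr/=.
by [].
Qed.

Lemma cost_to_go_hyb k dl t : cost_to_go tau dbar k dl t =
  \sum_(k.+1 <= j < N.+1) stage (hyb k dl) j t.
Proof.
rewrite /cost_to_go; apply: eq_big_nat => j /andP[kj jN].
rewrite /stage fires_hyb ltnNge (ltnW kj)/= gtn_eqF//.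
by rewrite !run_hyb subnKC// ltnW// leqW.
Qed.

Lemma reduced_cost_hyb k dl t : (k <= N)%N -> reduced_cost (hyb k dl) t =
  \sum_(0 <= j < k) stage tau j t + stage (hyb k dl) k t + cost_to_go tau dbar k dl t.
Proof.
move=> kN; rewrite /reduced_cost cost_to_go_hyb -(big_mkord xpredT (fun j => stage _ j t)).
rewrite (big_cat_nat (n := k)) ?leqW//= (big_cat_nat (n := k.+1) (m := k))//=.
rewrite big_nat1 addrA; congr (_ + _ + _); apply: eq_big_nat => j /andP[_ jk].
by rewrite /stage fires_hyb jk /err loop_hyb.
Qed.

Definition gap (k : nat) (t : T) : R :=
  reduced_cost (hyb k false) t - reduced_cost (hyb k true) t.

Lemma rint_gap k : rint P (gap k).
Proof. by apply: rintB; apply: rint_reduced_cost; exact: adapted_hyb. Qed.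

Lemma rint_cost_to_go k dl : rint P (cost_to_go tau dbar k dl).
Proof.
have -> : cost_to_go tau dbar k dl =
    (fun t => \sum_(k.+1 <= j < N.+1) stage (hyb k dl) j t).
  by apply/funext => t; rewrite cost_to_go_hyb.
(* [rint_sum] wants every index integrable, and stages are so up to the horizon only; the others
   become 0. *)
have -> : (fun t => \sum_(k.+1 <= j < N.+1) stage (hyb k dl) j t) =
    (fun t => \sum_(k.+1 <= j < N.+1)
      if (j <= N)%N then stage (hyb k dl) j t else 0).
  by apply/funext => t; apply: eq_big_nat => j /andP[_]; rewrite ltnS => ->.
apply: rint_sum => j /=; case: (leqP j N) => jN; last exact: rint_cst.
by apply: rint_stage => //; exact: adapted_hyb.
Qed.

Local Notation idx := ('I_n + 'I_n + bool)%type.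

(* [gap k - voi k] is the sum of these terms, each with vanishing conditional
   expectation given [G k] and a [G k]-measurable weight. *)
Definition innov (k : nat) (i : idx) (t : T) : R :=
  match i with
  | inl (inl i) => w k t i 0
  | inl (inr i) => xof (loop tau k t) i 0 - xc k t i 0
  | inr dl => cost_to_go tau dbar k dl t - (if dl then Z1 k t else Z0 k t)
  end.

Definition weight (k : nat) (i : idx) (t : T) : R :=
  let v := 2 *: ((Gam sys k.+1)^T *m g k t (loop tau k t)) in
  match i with
  | inl (inl i) => v i 0
  | inl (inr i) => ((A k)^T *m v) i 0
  | inr dl => if dl then -1 else 1
  end.

(** The two hybrids share their past, so earlier stages cancel. The stage at [k] contributes the
    trigger price and a difference of quadratic forms, the tails contribute the two predictions, and
    replacing unknowns by their estimates leaves the innovations. *)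
Lemma gapE k t : (k <= N)%N -> gap k t = voi k t + \sum_i weight k i t * innov k i t.
Proof.
move=> kN; set gk := g k t (loop tau k t).
(* [Gam_tr] stops at the horizon; at [k = N] the matrix is 0. *)
have Gtr : (Gam sys k.+1)^T = Gam sys k.+1.
  move: kN; rewrite leq_eqVlt => /orP[/eqP ->|]; last exact: Gam_tr.
  by rewrite /Gam ltnn trmx0.
have -> : \sum_i weight k i t * innov k i t =
    2 * bf gk (Gam sys k.+1) (w k t) +
    2 * bf gk (Gam sys k.+1) (A k *m (xof (loop tau k t) - xc k t)) +
    (cost_to_go tau dbar k false t - Z0 k t) - (cost_to_go tau dbar k true t - Z1 k t).
  have e1 : \sum_i weight k (inl (inl i)) t * innov k (inl (inl i)) t =
      2 * bf gk (Gam sys k.+1) (w k t).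
    by rewrite -bfZl bf_sum; apply: eq_bigr => i _; rewrite -scalemxAr.
  have e2 : \sum_i weight k (inl (inr i)) t * innov k (inl (inr i)) t =
      2 * bf gk (Gam sys k.+1) (A k *m (xof (loop tau k t) - xc k t)).
    rewrite -bfZl bf_mulr bf_sum; apply: eq_bigr => i _.
    rewrite trmx_mul -mulmxA -[in RHS](scalemxAr 2 _ gk).
    by congr (_ * _); rewrite !mxE.
  rewrite big_sumType big_sumType big_bool e1 e2 /= mulN1r mul1r; ring.
(* Both choices share state and input at time [k], so their next errors differ by the correction
   alone. *)
have errE dl : err (hyb k dl) k.+1 t =
    A k *m (xof (loop tau k t) - xhof (loop tau k t)) + w k t - (dl%:R : R) *: gk.
  rewrite /err loopS step_x step_xh fires_hyb ltnn eqxx loop_hyb//.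
  rewrite mulmxBr -/gk; move: (A k *m _) (A k *m _) (B k *m _) => a b c.
  by apply/matrixP => i j; rewrite !mxE; ring.
rewrite /gap !reduced_cost_hyb// /stage !fires_hyb ltnn eqxx !errE /voi -/gk.
set e := xof _ - xhof _.
have -> : 2 *: (A k *m (xc k t - xhof (loop tau k t))) - gk =
    2 *: (A k *m e) - 2 *: (A k *m (xof (loop tau k t) - xc k t)) - gk.
  rewrite -scalerBr -mulmxBr /e; congr (_ *: (_ *m _) - _).
  by apply/matrixP => i j; rewrite !mxE; ring.
rewrite scale0r scale1r subr0 !qfE !(bfDl, bfDr, bfNl, bfNr, bfZr).
rewrite (bf_tr (w k t) (Gam sys k.+1) gk) (bf_tr (A k *m e) (Gam sys k.+1) gk) Gtr.
by rewrite [_ * true%:R]mulr1 [_ * false%:R]mulr0; ring.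
Qed.

Lemma innov_orth k i : (k <= N)%N -> orth P (G k) (innov k i).
Proof.
move=> kN; have sGm : <<s G k >> `<=` measurable.
  apply: smallest_sub; first exact: sigma_algebra_measurable.
  move=> E /(GH kN); apply: smallest_sub => //; exact: sigma_algebra_measurable.
case: i => [[i|i]|[]] /=.
- by apply: orth_sub (w_orth kN i); exact: GH.
- exact: xc_cond.
- exact: orth_cond_exp sGm (rint_cost_to_go k true) (Z1_cond kN).
- exact: orth_cond_exp sGm (rint_cost_to_go k false) (Z0_cond kN).
Qed.

Lemma weight_meas k i : (k <= N)%N -> gmeas (G k) (weight k i).
Proof.
move=> kN.
have Gv : vgm (G k) (fun t => 2 *: ((Gam sys k.+1)^T *m g k t (loop tau k t))).
  have := vgm_mulmxl (2 *: (Gam sys k.+1)^T) (gG kN); congr vgm.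
  by apply/funext => t; rewrite scalemxAl.
case: i => [[i|i]|[]]; rewrite /weight.
- exact: Gv.
- exact: vgm_mulmxl.
- exact: measurable_cst.
- exact: measurable_cst.
Qed.

Lemma rollout_step k : (k <= N)%N ->
  \int[P]_t reduced_cost (hyb k.+1 (dbar k.+1)) t <=
  \int[P]_t reduced_cost (hyb k (dbar k)) t.
Proof.
move=> kN; have rc j dl := rint_reduced_cost (@adapted_hyb j dl).
have Gm : G k `<=` measurable.
  move=> E /(GH kN); apply: smallest_sub => //; exact: sigma_algebra_measurable.
(* With the sample point fixed, the decision of [tau] at time [k] is a constant and can be passed as
   [dl]. *)
have step1 t : reduced_cost (hyb k.+1 (dbar k.+1)) t = reduced_cost (hyb k (fires tau k t)) t.
  apply: reduced_cost_ext => j jN; rewrite fires_hyb /hyb ltnS.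
  case: ltngtP => [jk|kj|->].
  - by rewrite loop_hyb// leqW// ltnW.
  - by case: eqP => // ->.
  - by [].
rewrite -subr_ge0 -RintB//.
(* The hybrids differ only where [tau] disagrees with the schedule: on the event of not firing when
   [dbar k] holds, on the event of firing otherwise. The sign of [voi] is known on each. *)
have -> : \int[P]_t (reduced_cost (hyb k (dbar k)) t -
      reduced_cost (hyb k.+1 (dbar k.+1)) t) =
    if dbar k then \int[P]_t ((~~ fires tau k t)%:R * - gap k t)
    else \int[P]_t ((fires tau k t)%:R * gap k t).
  case: (dbar k); apply: eq_Rintegral => t _; rewrite step1 /gap;
    case: (fires tau k t); rewrite ?subrr ?mul0r ?mul1r//.
  by rewrite opprB.
case: ifP => _.
- apply: (@Rint_ge0_of_orth _ _ _ P (G k) Gm _ (innov k) (fun i t => - weight k i t)).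
  + by move=> i; exact: innov_orth.
  + by move=> i; apply: measurableT_comp => //; exact: weight_meas.
  + exact: rintN (rint_gap k).
  + exact: gbool_neg (tauG kN).
  + move=> t; rewrite tau_voi// -ltNge gapE// => /ltW v0.
    rewrite (eq_bigr (fun i => - (weight k i t * innov k i t))); last first.
      by move=> i _; rewrite mulNr.
    by rewrite sumrN lerN2 gerDr.
- apply: (@Rint_ge0_of_orth _ _ _ P (G k) Gm _ (innov k) (weight k)).
  + by move=> i; exact: innov_orth.
  + by move=> i; exact: weight_meas.
  + exact: rint_gap.
  + exact: tauG.
  + by move=> t; rewrite tau_voi// gapE// => v0; rewrite lerDr.
Qed.

Theorem rollout_improves : (\int[P]_t (total_cost tau t)%:E <=
  \int[P]_t (total_cost (fun k _ _ => dbar k) t)%:E)%E.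
Proof.
rewrite !total_cost_int; [|exact: adapted_dbar|exact: adapted_tau].
rewrite lee_fin lerD2l.
have -> : \int[P]_t reduced_cost tau t =
    \int[P]_t reduced_cost (hyb N.+1 (dbar N.+1)) t.
  apply: eq_Rintegral => t _; apply: reduced_cost_ext => j jN.
  by rewrite /hyb ltnS jN.
have -> : \int[P]_t reduced_cost (fun k _ _ => dbar k) t =
    \int[P]_t reduced_cost (hyb 0 (dbar 0%N)) t.
  apply: eq_Rintegral => t _; apply: reduced_cost_ext => j jN.
  by rewrite /hyb /fires; case: eqP => // ->.
have: (N.+1 <= N.+1)%N by [].
(* Only the index of the hybrid is generalised; the bound keeps the horizon. *)
elim: {1 3 4}N.+1 => [//|k ih] kN.
exact: le_trans (rollout_step kN) (ih (ltnW kN)).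
Qed.

End Rollout.

(** * Finitely valued random elements *)

Section FiniteValued.
Context {R : realType} {d : measure_display} {T : measurableType d}.
Implicit Types G : set (set T).

(** Preimages of all sets are required, so any function of [f] is measurable whatever its
    regularity; this covers [invmx] in the Kalman gain. *)
Definition simple_in G (X : Type) (f : T -> X) : Prop :=
  finite_set (range f) /\ forall D : set X, <<s G >> (f @^-1` D).

Lemma simple_in_sub G H (X : Type) (f : T -> X) : G `<=` <<s H >> ->
  simple_in G f -> simple_in H f.
Proof.
move=> GH [ff Gf]; split=> // D; have := Gf D.
by apply: smallest_sub => //; exact: smallest_sigma_algebra.
Qed.

Lemma simple_in_cst G (X : Type) (a : X) : simple_in G (fun=> a).
Proof.
split.
  by apply: (sub_finite_set _ (finite_set1 a)) => _ [t _ <-].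
move=> D; have [aD|aD] := pselect (D a).
  rewrite (_ : _ @^-1` _ = setT); last by apply/seteqP; split.
  exact: (@measurableT _ (g_sigma_algebraType G)).
rewrite (_ : _ @^-1` _ = set0); last by apply/seteqP; split.
exact: (@measurable0 _ (g_sigma_algebraType G)).
Qed.

Lemma simple_in_step G (X Y : Type) (f : T -> X) (b : T -> bool) (phi : bool -> X -> Y) :
  gbool G b -> simple_in G f -> simple_in G (fun t => phi (b t) (f t)).
Proof.
move=> Gb [ff Gf]; split.
  apply: (@sub_finite_set _ _ (phi true @` range f `|` phi false @` range f)).
    move=> _ [t _ <-]; case: (b t); [left|right]; exists (f t) => //; exists t => //.
  by rewrite finite_setU; split; exact: finite_image.
move=> D; rewrite (_ : _ @^-1` D = ([set t | b t] `&` (f @^-1` (phi true @^-1` D))) `|`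
    ([set t | ~~ b t] `&` (f @^-1` (phi false @^-1` D)))).
  apply: (@measurableU _ (g_sigma_algebraType G));
    apply: (@measurableI _ (g_sigma_algebraType G)) => //.
  - exact: Gf.
  - exact: gbool_neg.
  - exact: Gf.
apply/seteqP; split=> t /=; first by case: (b t) => ?; [left|right].
by case: (b t) => [[[]|[]]|[[]|[]]].
Qed.

Lemma simple_in_gmeas G (X : Type) (f : T -> X) (h : X -> R) : simple_in G f ->
  gmeas G (fun t => h (f t)).
Proof. by move=> [_ Gf]; apply: gmeasP => B _; exact: (Gf (h @^-1` B)). Qed.

Lemma simple_in_bounded G (X : Type) (f : T -> X) p q (h : X -> 'M[R]_(p, q)) :
  simple_in G f -> exists c, forall t i j, `|h (f t) i j| <= c.
Proof.
move=> [ff _]; pose N x := \sum_i \sum_j `|h x i j|.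
have [s sN] : exists s : seq R, [set N x | x in range f] = [set` s].
  by apply/finite_seqP; exact: finite_image.
(* [s] lists the finitely many values of [N], and [N] dominates each entry; summing the list bounds
   them all. *)
exists (\sum_(y <- s) `|y|) => t i j.
have Ns : N (f t) \in s.
  have : [set N x | x in range f] (N (f t)) by exists (f t) => //; exists t.
  by rewrite sN.
apply: (@le_trans _ _ (N (f t))).
  rewrite /N (bigD1 i)//= (bigD1 j)//= -addrA lerDl addr_ge0//; apply: sumr_ge0 => // a _.
  exact: sumr_ge0.
rewrite (le_trans (ler_norm _))// (big_rem _ Ns)/= lerDl.
exact: sumr_ge0.
Qed.

End FiniteValued.

(** * The filtration generated by past noise *)

Section NoiseFiltration.
Context {R : realType} {d : measure_display} {T : measurableType d}.
Variable P : probability T R.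

Lemma vsigma_sigma_algebra q (X : T -> 'cV[R]_q) : sigma_algebra setT (vsigma X).
Proof. exact: smallest_sigma_algebra. Qed.

Lemma vsigma_measurable q (X : T -> 'cV[R]_q) : rv_vec X -> vsigma X `<=` measurable.
Proof.
move=> mX; apply: smallest_sub; first exact: sigma_algebra_measurable.
by move=> _ [i [B [mB ->]]]; rewrite -[X in measurable X]setTI; exact: mX.
Qed.

Lemma vsigma_preimage q (X : T -> 'cV[R]_q) i (B : set R) : measurable B ->
  vsigma X ((fun t => X t i 0) @^-1` B).
Proof. by move=> mB; apply: sub_sigma_algebra; exists i, B. Qed.

Variables (valid : noise_idx -> Prop) (F : noise_idx -> set (set T)).
Hypothesis FS : forall i, valid i -> sigma_algebra setT (F i).
Hypothesis Fm : forall i, valid i -> F i `<=` measurable.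
Hypothesis indF : mutually_indep P valid F.

(* The noise that has entered the loop by the time delta_k is chosen: v_k has, w_k has not. *)
Definition past (k : nat) (i : noise_idx) : Prop :=
  match i with NX0 => True | NW j => (j < k)%N | NV j => (j <= k)%N end.

Definition noise_gen (k : nat) : set (set T) := joint_gen valid F (past k).

Lemma noise_gen_measurable k : noise_gen k `<=` measurable.
Proof. exact: joint_gen_measurable. Qed.

Lemma noise_gen_mono j k : (j <= k)%N -> noise_gen j `<=` <<s noise_gen k >>.
Proof.
move=> jk E [i [vi Si FE]]; apply: sub_sigma_algebra; exists i; split=> //.
by case: i Si {vi FE} => [|i|i] //= ij; exact: leq_trans ij jk.
Qed.

Lemma vgm_noise k i q (X : T -> 'cV[R]_q) : valid i -> past k i -> F i = vsigma X ->
  vgm (noise_gen k) X.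
Proof.
move=> vi pi FX a b; rewrite [b]ord1; apply: gmeasP => B mB.
by apply: sub_sigma_algebra; exists i; rewrite FX; split=> //; exact: vsigma_preimage.
Qed.

Lemma noise_orth k q (X : T -> 'cV[R]_q) M a : valid (NW k) -> F (NW k) = vsigma X ->
  rv_vec X -> gauss_vec P X 0 M -> orth P (noise_gen k) (fun t => X t a 0).
Proof.
move=> vk FX mX gX; apply: (indep_orth FS Fm indF vk).
- by rewrite /past ltnn.
- by move=> B mB; rewrite FX; exact: vsigma_preimage.
- exact: L2_rint (gauss_vec_L2 a mX gX).
- exact: gauss_vec_mean0 mX gX.
Qed.

Lemma gauss_vec_vL2 q (X : T -> 'cV[R]_q) mu M : rv_vec X -> gauss_vec P X mu M ->
  vL2 P X.
Proof. by move=> mX gX a b; rewrite [b]ord1; exact: gauss_vec_L2 mX gX. Qed.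

End NoiseFiltration.

Section HistorySigma.
Context {R : realType} {d : measure_display} {T : measurableType d}.

(** The generating family inside [hist_sigma], so that [hist_sigma Y k] is [<<s hist_gen Y k>>] by
    conversion. *)
Definition hist_gen (q : nat) (Y : nat -> T -> 'cV[R]_q) (k : nat) : set (set T) :=
  [set E | exists (j : nat) (i : 'I_q) (B : set R), (j <= k)%N /\ measurable B /\
           E = (fun t => Y j t i 0) @^-1` B].

Lemma hist_gen_mono q (Y : nat -> T -> 'cV[R]_q) j k : (j <= k)%N ->
  hist_gen Y j `<=` <<s hist_gen Y k >>.
Proof.
move=> jk E [a [i [B [aj [mB ->]]]]]; apply: sub_sigma_algebra.
by exists a, i, B; split=> //; exact: leq_trans jk.
Qed.

Lemma vgm_hist q (Y : nat -> T -> 'cV[R]_q) k : vgm (hist_gen Y k) (Y k).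
Proof.
move=> i b; rewrite [b]ord1; apply: gmeasP => B mB.
by apply: sub_sigma_algebra; exists k, i, B.
Qed.

Lemma hist_gen_sub q (Y : nat -> T -> 'cV[R]_q) k (H : set (set T)) :
  (forall j, (j <= k)%N -> vgm H (Y j)) -> hist_gen Y k `<=` <<s H >>.
Proof.
move=> HY E [j [i [B [jk [mB ->]]]]]; rewrite -[X in <<s _ >> X]setTI.
exact: HY jk i 0 (@measurableT _ (g_sigma_algebraType H)) B mB.
Qed.

End HistorySigma.

(** * The two information patterns *)

Section PerfectInformation.
Context {R : realType} {d : measure_display} {T : measurableType d}.
Variable P : probability T R.
Context {n m : nat} (sys : lqsys R n m) (m0 : 'cV[R]_n) (M0 : 'M[R]_n).
Variables (x0 : T -> 'cV[R]_n) (w : nat -> T -> 'cV[R]_n) (dbar : nat -> bool).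
Local Notation N := (horizon sys).
Local Notation A := (Am sys).
Local Notation B := (Bm sys).
Local Notation L := (Lgain sys).
Hypothesis pQ : forall k, (k <= N.+1)%N -> psd (Qm sys k).
Hypothesis pR : forall k, (k <= N)%N -> pd (Rm sys k).
Hypothesis mx0 : rv_vec x0.
Hypothesis gx0 : gauss_vec P x0 m0 M0.
Hypothesis gw : forall k, (k <= N)%N -> rv_vec (w k) /\ gauss_vec P (w k) 0 (Wm sys k).
Let valid i := match i with NX0 => True | NW k => is_true (k <= N)%N | NV _ => False end.
Let F i := match i with NX0 => vsigma x0 | NW k => vsigma (w k) | NV _ => set0 end.
Hypothesis indF : mutually_indep P valid F.

Let FS i : valid i -> sigma_algebra setT (F i).
Proof. by case: i => [|k|k] //= _; exact: vsigma_sigma_algebra. Qed.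

Let Fm i : valid i -> F i `<=` measurable.
Proof.
by case: i => [|k|k] //= vk; apply: vsigma_measurable => //; have [] := gw vk.
Qed.

Local Notation St := ('cV[R]_n * 'cV[R]_n)%type.

Let step k t (s : St) b : St := pstep sys k s b (w k t).
Let g k (t : T) (s : St) : 'cV[R]_n := A k *m (s.1 - s.2).
Let s0 t : St := (x0 t, m0).
Let H := noise_gen valid F.

Local Notation lp := (loop step s0).
Local Notation fire := (fires step s0).

(** Decisions are constrained before [k] only, so that [perfect_hist_noise] can use this inside its
    induction, where nothing later is known. *)
Lemma perfect_regular trig k :
  (forall j, (j < k)%N -> gbool (H j) (fire trig j)) -> (k <= N.+1)%N ->
  [/\ vgm (H k) (fun t => (lp trig k t).1), vL2 P (fun t => (lp trig k t).1),
      vgm (H k) (fun t => (lp trig k t).2) & vL2 P (fun t => (lp trig k t).2)].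
Proof.
elim: k => [|k ih] ad kN.
  split; [exact: (@vgm_noise _ _ _ _ _ _ NX0)|exact: gauss_vec_vL2 mx0 gx0| |].
    exact: vgm_cst.
  exact: vL2_cst.
have [Gx Lx Gxh Lxh] := ih (fun j jk => ad j (ltnW jk)) (ltnW kN).
have [mw gwk] := gw kN.
have Hk : H k `<=` <<s H k.+1 >> by exact: noise_gen_mono.
have Gu : vgm (H k) (fun t => B k *m (- (L k *m (lp trig k t).2))).
  by apply: vgm_mulmxl; apply: vgmN; exact: vgm_mulmxl.
have Lu : vL2 P (fun t => B k *m (- (L k *m (lp trig k t).2))).
  by apply: vL2_mulmxl; apply: vL2N; exact: vL2_mulmxl.
have xE : (fun t => (lp trig k.+1 t).1) = (fun t => A k *m (lp trig k t).1 +
    B k *m (- (L k *m (lp trig k t).2)) + w k t).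
  by apply/funext => t; rewrite loopS.
have xhE : (fun t => (lp trig k.+1 t).2) = (fun t => A k *m (lp trig k t).2 +
    B k *m (- (L k *m (lp trig k t).2)) +
    ((fire trig k t)%:R : R) *: (A k *m ((lp trig k t).1 - (lp trig k t).2))).
  by apply/funext => t; rewrite loopS.
rewrite xE xhE; split.
- apply: vgmD; last by apply: (@vgm_noise _ _ _ _ _ _ (NW k)) => //=.
  by apply: (vgm_sub Hk); apply: vgmD => //; exact: vgm_mulmxl.
- by apply: vL2D; [apply: vL2D => //; exact: vL2_mulmxl|exact: gauss_vec_vL2 mw gwk].
- apply: (vgm_sub Hk); apply: vgmD; first by apply: vgmD => //; exact: vgm_mulmxl.
  by apply: vgm_bool; [exact: ad|apply: vgm_mulmxl; exact: vgmB].
- apply: vL2D; first by apply: vL2D => //; exact: vL2_mulmxl.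
  apply: (@vL2_bool _ _ _ _ (H k)); [exact: noise_gen_measurable|exact: ad|].
  by apply: vL2_mulmxl; exact: vL2B.
Qed.

Variables (rho : nat -> T -> R).
Let tau := pplus sys rho.
Let Y j t := (lp tau j t).1.
Let G := hist_gen Y.

Variables Z0 Z1 : nat -> T -> R.
Hypothesis Z0_cond : forall k, (k <= N)%N ->
  cond_exp_of P <<s G k >> (pVcf sys m0 x0 w tau dbar k false) (Z0 k).
Hypothesis Z1_cond : forall k, (k <= N)%N ->
  cond_exp_of P <<s G k >> (pVcf sys m0 x0 w tau dbar k true) (Z1 k).
Hypothesis rhoE : forall k t, (k <= N)%N -> rho k t = Z0 k t - Z1 k t.

Lemma perfect_xh_meas k :
  (forall j, (j < k)%N -> gbool (G j) (fire tau j)) -> vgm (G k) (fun t => (lp tau k t).2).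
Proof.
elim: k => [|k ih] ad; first exact: vgm_cst.
have Gxh := ih (fun j jk => ad j (ltnW jk)).
have xhE : (fun t => (lp tau k.+1 t).2) = (fun t => A k *m (lp tau k t).2 +
    B k *m (- (L k *m (lp tau k t).2)) +
    ((fire tau k t)%:R : R) *: (A k *m ((lp tau k t).1 - (lp tau k t).2))).
  by apply/funext => t; rewrite loopS.
rewrite xhE; apply: (@vgm_sub _ _ _ (G k)); first exact: hist_gen_mono.
apply: vgmD.
  by apply: vgmD; apply: vgm_mulmxl => //; apply: vgmN; exact: vgm_mulmxl.
by apply: vgm_bool; [exact: ad|apply: vgm_mulmxl; apply: vgmB => //; exact: vgm_hist].
Qed.

Lemma perfect_fires_voi k t : (k <= N)%N -> fire tau k t =
  (0 <= voi sys step (fun s : St => s.2) g s0 tau (fun k t => (lp tau k t).1) Z0 Z1 k t).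
Proof.
move=> kN; rewrite /fires /tau /pplus /voi rhoE// /g; congr (0 <= _ - _ + _).
(* The correction is [A k *m e] itself, so twice that vector minus the correction is again
   [A k *m e]. *)
set e := _ - _; rewrite scaler_nat mulr2n addrK.
by rewrite bf_mull bf_mulr.
Qed.

(** The decision at [k] reads the estimate, which earlier decisions have shaped; hence the strong
    induction. *)
Lemma perfect_fires_meas k : (k <= N)%N -> gbool (G k) (fire tau k).
Proof.
elim/ltn_ind: k => k ih kN.
have Gxh : vgm (G k) (fun t => (lp tau k t).2).
  by apply: perfect_xh_meas => j jk; apply: ih => //; rewrite (leq_trans _ kN)// ltnW.
have Ge : vgm (G k) (fun t => (lp tau k t).1 - (lp tau k t).2).
  by apply: vgmB => //; exact: vgm_hist.
apply: gbool_ler; first exact: measurable_cst.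
have GZ0 : gmeas (G k) (Z0 k) by apply: gmeasP; case: (Z0_cond kN).
have GZ1 : gmeas (G k) (Z1 k) by apply: gmeasP; case: (Z1_cond kN).
apply: measurable_funD; last first.
  rewrite (_ : rho k = fun t => Z0 k t - Z1 k t); last first.
    by apply/funext => t; rewrite rhoE.
  exact: measurable_funB.
apply: measurable_funB; last exact: measurable_cst.
have GM := @vgm_cst _ _ _ (G k) _ _ ((A k)^T *m Gam sys k.+1 *m A k).
have := vgm_mulmx (vgm_mulmx (vgm_tr Ge) GM) Ge.
by move=> /(_ 0 0).
Qed.

(** Earlier decisions are functions of earlier histories, which by induction are functions of past
    noise; the state they lead to is then one as well. *)
Lemma perfect_hist_noise k : (k <= N)%N -> G k `<=` <<s H k >>.
Proof.
elim/ltn_ind: k => k ih kN; apply: hist_gen_sub => j jk.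
apply: (vgm_sub (noise_gen_mono (valid := valid) (F := F) jk)).
have [|//] := @perfect_regular tau j _ (leqW (leq_trans jk kN)).
move=> i ij; have ik := leq_trans ij jk; have iN := leq_trans (ltnW ik) kN.
by apply: gbool_sub (perfect_fires_meas iN); exact: ih.
Qed.

Lemma perfect_improves :
  (pPsi sys m0 x0 w P tau <= pPsi sys m0 x0 w P (fun k _ _ => dbar k))%E.
Proof.
apply: (@rollout_improves _ _ _ P _ _ sys pQ pR St step (fun s => s.1) (fun s => s.2) w g s0
  _ _ H G _ perfect_hist_noise _ _ _ _ tau dbar (fun k t => (lp tau k t).1) Z0 Z1
  perfect_fires_meas _ _ Z0_cond Z1_cond perfect_fires_voi).
- by [].
- by [].
- by move=> k; exact: noise_gen_measurable.
- by split; [exact: gauss_vec_vL2 mx0 gx0|exact: vL2_cst].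
- by move=> k kN; have [mw gwk] := gw kN; exact: gauss_vec_vL2 mw gwk.
- move=> k kN i; have [mw gwk] := gw kN.
  exact: (@noise_orth _ _ _ P valid F FS Fm indF k n (w k) (Wm sys k) i kN erefl mw gwk).
- move=> trig ad k kN; apply: perfect_regular => // j jk.
  by apply: ad; rewrite -ltnS (leq_trans jk).
- move=> k kN; apply: vgm_mulmxl; apply: vgmB; first exact: vgm_hist.
  apply: perfect_xh_meas => j jk; apply: perfect_fires_meas.
  by rewrite (leq_trans _ kN)// ltnW.
(* The state is observed exactly, so its estimation error is identically 0. *)
- move=> k kN i; under eq_fun do rewrite subrr.
  by split; [exact: rint_cst|move=> E _; rewrite integral0].
Qed.

End PerfectInformation.

(** * Noisy observations and the Kalman filter *)

Section ImperfectInformation.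
Context {R : realType} {d : measure_display} {T : measurableType d}.
Variable P : probability T R.
Context {n m p : nat} (sys : lqsys R n m) (C : nat -> 'M[R]_(p, n)) (V : nat -> 'M[R]_p).
Variables (m0 : 'cV[R]_n) (M0 : 'M[R]_n) (x0 : T -> 'cV[R]_n).
Variables (w : nat -> T -> 'cV[R]_n) (v : nat -> T -> 'cV[R]_p) (dbar : nat -> bool).
Local Notation N := (horizon sys).
Local Notation A := (Am sys).
Local Notation B := (Bm sys).
Local Notation L := (Lgain sys).
Hypothesis pQ : forall k, (k <= N.+1)%N -> psd (Qm sys k).
Hypothesis pR : forall k, (k <= N)%N -> pd (Rm sys k).
Hypothesis mx0 : rv_vec x0.
Hypothesis gx0 : gauss_vec P x0 m0 M0.
Hypothesis gw : forall k, (k <= N)%N -> rv_vec (w k) /\ gauss_vec P (w k) 0 (Wm sys k).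
Hypothesis gv : forall k, (k <= N)%N -> rv_vec (v k) /\ gauss_vec P (v k) 0 (V k).
Let valid i :=
  match i with NX0 => True | NW k => is_true (k <= N)%N | NV k => is_true (k <= N)%N end.
Let F i := match i with NX0 => vsigma x0 | NW k => vsigma (w k) | NV k => vsigma (v k) end.
Hypothesis indF : mutually_indep P valid F.

Let FS i : valid i -> sigma_algebra setT (F i).
Proof. by case: i => [|k|k] /= _; exact: vsigma_sigma_algebra. Qed.

Let Fm i : valid i -> F i `<=` measurable.
Proof.
by case: i => [|k|k] /= vk; apply: vsigma_measurable => //;
  [have [] := gw vk|have [] := gv vk].
Qed.

Local Notation St := (@istate R n).

Let step k t (s : St) b : St := istep sys C V k s b (w k t) (v k t).
Let g k (t : T) (s : St) : 'cV[R]_n :=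
  Kgain sys C V k (iP s) *m (C k *m ix s + v k t - C k *m ixh s).
Let s0 t : St := (x0 t, m0, M0).
Let H := noise_gen valid F.

Local Notation lp := (loop step s0).
Local Notation fire := (fires step s0).

Let stepx k t s b :
  ix (step k t s b) = A k *m ix s + B k *m (- (L k *m ixh s)) + w k t.
Proof. by case: s => [[]]. Qed.

Let stepxh k t s b : ixh (step k t s b) =
  A k *m ixh s + B k *m (- (L k *m ixh s)) + (b%:R : R) *: g k t s.
Proof. by case: s => [[]]. Qed.

(** A function of the trigger bit and the previous covariance only, as [simple_in_step] demands. *)
Let cov k (b : bool) (Pk : 'M[R]_n) : 'M[R]_n := A k *m Pk *m (A k)^T + Wm sys k
  - (b%:R : R) *: (Kgain sys C V k Pk *m C k *m Pk *m (A k)^T).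

Let stepP k t s b : iP (step k t s b) = cov k b (iP s).
Proof. by case: s => [[]]. Qed.

Let obs trig k t := C k *m ix (lp trig k t) + v k t.

(* The covariance recursion is driven by the triggers alone, so it takes finitely many
   values; this makes the random Kalman gain measurable and bounded. *)
Lemma filter_meas (FF : nat -> set (set T)) trig k :
  (forall i j, (i <= j)%N -> FF i `<=` <<s FF j >>) ->
  (forall j, (j < k)%N -> gbool (FF j) (fire trig j) /\ vgm (FF j) (obs trig j)) ->
  simple_in (FF k) (fun t => iP (lp trig k t)) /\ vgm (FF k) (fun t => ixh (lp trig k t)).
Proof.
move=> mono; elim: k => [|k ih] ad; first by split; [exact: simple_in_cst|exact: vgm_cst].
have [SP Gxh] := ih (fun j jk => ad j (ltnW jk)).
have [Gf Gy] := ad k (ltnSn k).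
have PE : (fun t => iP (lp trig k.+1 t)) =
    (fun t => cov k (fire trig k t) (iP (lp trig k t))).
  by apply/funext => t; rewrite loopS stepP.
have xhE : (fun t => ixh (lp trig k.+1 t)) = (fun t => A k *m ixh (lp trig k t) +
    B k *m (- (L k *m ixh (lp trig k t))) +
    ((fire trig k t)%:R : R) *: (Kgain sys C V k (iP (lp trig k t)) *m
      (obs trig k t - C k *m ixh (lp trig k t)))).
  by apply/funext => t; rewrite loopS stepxh.
rewrite PE xhE; split.
  by apply: (simple_in_sub (mono k k.+1 (leqnSn k))); exact: simple_in_step.
apply: (vgm_sub (mono k k.+1 (leqnSn k))); apply: vgmD.
  by apply: vgmD; apply: vgm_mulmxl => //; apply: vgmN; exact: vgm_mulmxl.
apply: vgm_bool => //; apply: vgm_mulmx.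
  by move=> i j; exact: (simple_in_gmeas (fun Q => Kgain sys C V k Q i j) SP).
by apply: vgmB => //; exact: vgm_mulmxl.
Qed.

Let Hmono i j : (i <= j)%N -> H i `<=` <<s H j >>.
Proof. exact: noise_gen_mono. Qed.

(** Strong induction, because [filter_meas] consumes all past observations. The last clause is
    restricted to the horizon, where the observation noise is specified, while the state itself is
    needed one step further. *)
Lemma imperfect_state trig k :
  (forall j, (j < k)%N -> gbool (H j) (fire trig j)) -> (k <= N.+1)%N ->
  [/\ vgm (H k) (fun t => ix (lp trig k t)), vL2 P (fun t => ix (lp trig k t)),
      vL2 P (fun t => ixh (lp trig k t)) & (k <= N)%N -> vgm (H k) (obs trig k)].
Proof.
have obsH j : vgm (H j) (fun t => ix (lp trig j t)) -> (j <= N)%N -> vgm (H j) (obs trig j).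
  move=> Gx jN; apply: vgmD; first exact: vgm_mulmxl.
  by apply: (@vgm_noise _ _ _ _ _ _ (NV j)) => //=.
elim/ltn_ind: k => -[_|k ih] ad kN.
  have Gx : vgm (H 0) (fun t => ix (lp trig 0 t)) by exact: (@vgm_noise _ _ _ _ _ _ NX0).
  split; [exact: Gx|exact: gauss_vec_vL2 mx0 gx0|exact: vL2_cst|exact: obsH].
have ihj j : (j <= k)%N -> [/\ vgm (H j) (fun t => ix (lp trig j t)),
    vL2 P (fun t => ix (lp trig j t)), vL2 P (fun t => ixh (lp trig j t)) &
    (j <= N)%N -> vgm (H j) (obs trig j)].
  move=> jk; apply: ih => //; last by rewrite (leq_trans jk)// ltnW.
  by move=> i ij; apply: ad; rewrite (leq_trans ij)// leqW.
have [Gx Lx Lxh Gy] := ihj k (leqnn k).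
have [SP Gxh] : simple_in (H k) (fun t => iP (lp trig k t)) /\
    vgm (H k) (fun t => ixh (lp trig k t)).
  apply: filter_meas => // j jk; split; first by apply: ad; exact: leqW.
  by have [_ _ _] := ihj j (ltnW jk); apply; exact: leq_trans (ltnW jk) (kN : (k <= N)%N).
have [mw gwk] := gw kN; have [mv gvk] := gv kN.
have Lu : vL2 P (fun t => B k *m (- (L k *m ixh (lp trig k t)))).
  by apply: vL2_mulmxl; apply: vL2N; exact: vL2_mulmxl.
have xE : (fun t => ix (lp trig k.+1 t)) = (fun t => A k *m ix (lp trig k t) +
    B k *m (- (L k *m ixh (lp trig k t))) + w k t).
  by apply/funext => t; rewrite loopS stepx.
have xhE : (fun t => ixh (lp trig k.+1 t)) = (fun t => A k *m ixh (lp trig k t) +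
    B k *m (- (L k *m ixh (lp trig k t))) +
    ((fire trig k t)%:R : R) *: (Kgain sys C V k (iP (lp trig k t)) *m
      (C k *m ix (lp trig k t) + v k t - C k *m ixh (lp trig k t)))).
  by apply/funext => t; rewrite loopS stepxh.
have Gx1 : vgm (H k.+1) (fun t => ix (lp trig k.+1 t)).
  rewrite xE; apply: vgmD; last by apply: (@vgm_noise _ _ _ _ _ _ (NW k)) => //=.
  apply: (vgm_sub (Hmono (leqnSn k))); apply: vgmD; apply: vgm_mulmxl => //.
  by apply: vgmN; exact: vgm_mulmxl.
split=> //; last exact: obsH.
- rewrite xE; apply: vL2D; last exact: gauss_vec_vL2 mw gwk.
  by apply: vL2D => //; exact: vL2_mulmxl.
- rewrite xhE; apply: vL2D; first by apply: vL2D => //; exact: vL2_mulmxl.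
  apply: (@vL2_bool _ _ _ _ (H k)); [exact: noise_gen_measurable|exact: ad|].
  (* A uniform bound on the random gain keeps the corrected estimate square-integrable. *)
  have [c Kc] := simple_in_bounded (fun Q => Kgain sys C V k Q) SP.
  apply: (@vL2_mulmx_bounded _ _ _ _ c).
  + move=> i j; apply: (@gmeas_measurable _ _ _ (H k)); first exact: noise_gen_measurable.
    exact: (simple_in_gmeas (fun Q => Kgain sys C V k Q i j) SP).
  + by move=> t i j; exact: Kc.
  + apply: vL2B; last exact: vL2_mulmxl.
    by apply: vL2D; [exact: vL2_mulmxl|exact: gauss_vec_vL2 mv gvk].
Qed.

Lemma imperfect_regular trig k :
  (forall j, (j < k)%N -> gbool (H j) (fire trig j)) -> (k <= N.+1)%N ->
  [/\ vgm (H k) (fun t => ix (lp trig k t)), vL2 P (fun t => ix (lp trig k t)),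
      vgm (H k) (fun t => ixh (lp trig k t)) & vL2 P (fun t => ixh (lp trig k t))].
Proof.
move=> ad kN; have [Gx Lx Lxh _] := imperfect_state ad kN; split=> //.
have [//|_ //] := @filter_meas H trig k Hmono.
move=> j jk; split; first exact: ad.
have jN : (j <= N)%N by rewrite -ltnS (leq_trans jk).
have [|_ _ _] := @imperfect_state trig j _ (leqW jN); last by apply.
by move=> i ij; apply: ad; exact: ltn_trans jk.
Qed.

Variables (xc : nat -> T -> 'cV[R]_n) (rho : nat -> T -> R).
Let tau := iplus sys C V v rho xc.
Let G := hist_gen (obs tau).

Variables Z0 Z1 : nat -> T -> R.
Hypothesis xc_cond : forall k, (k <= N)%N -> forall i : 'I_n,
  cond_exp_of P <<s G k >> (fun t => ix (lp tau k t) i 0) (fun t => xc k t i 0).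
Hypothesis Z0_cond : forall k, (k <= N)%N ->
  cond_exp_of P <<s G k >> (iVcf sys C V m0 M0 x0 w v tau dbar k false) (Z0 k).
Hypothesis Z1_cond : forall k, (k <= N)%N ->
  cond_exp_of P <<s G k >> (iVcf sys C V m0 M0 x0 w v tau dbar k true) (Z1 k).
Hypothesis rhoE : forall k t, (k <= N)%N -> rho k t = Z0 k t - Z1 k t.

Lemma imperfect_fires_voi k t : (k <= N)%N ->
  fire tau k t = (0 <= voi sys step (@ixh R n) g s0 tau xc Z0 Z1 k t).
Proof.
move=> kN; rewrite /fires /tau /iplus /voi rhoE// /g /bf; congr (0 <= _ - _ + _).
by rewrite [in RHS]trmx_mul.
Qed.

(** Here [filter_meas] is applied to the history of observations; [imperfect_state] applies it to
    the noise filtration. *)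
Lemma imperfect_gain_meas k :
  (forall j, (j < k)%N -> gbool (G j) (fire tau j)) ->
  vgm (G k) (fun t => ixh (lp tau k t)) /\ vgm (G k) (fun t => g k t (lp tau k t)).
Proof.
move=> ad; have Gy : vgm (G k) (obs tau k) by exact: vgm_hist.
have [|SP Gxh] := @filter_meas G tau k (@hist_gen_mono _ _ _ _ _).
  by move=> j jk; split; [exact: ad|exact: vgm_hist].
split=> //; apply: vgm_mulmx.
  by move=> i j; exact: (simple_in_gmeas (fun Q => Kgain sys C V k Q i j) SP).
by apply: vgmB => //; exact: vgm_mulmxl.
Qed.

Lemma imperfect_fires_meas k : (k <= N)%N -> gbool (G k) (fire tau k).
Proof.
elim/ltn_ind: k => k ih kN.
have [Gxh Gg] : vgm (G k) (fun t => ixh (lp tau k t)) /\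
    vgm (G k) (fun t => g k t (lp tau k t)).
  apply: imperfect_gain_meas => j jk; apply: ih => //.
  by rewrite (leq_trans _ kN)// ltnW.
have Gxc : vgm (G k) (xc k).
  by move=> i j; rewrite [j]ord1; apply: gmeasP; case: (xc_cond kN i).
have -> : fire tau k = (fun t => 0 <= voi sys step (@ixh R n) g s0 tau xc Z0 Z1 k t).
  by apply/funext => t; exact: imperfect_fires_voi.
apply: gbool_ler; first exact: measurable_cst.
have GZ0 : gmeas (G k) (Z0 k) by apply: gmeasP; case: (Z0_cond kN).
have GZ1 : gmeas (G k) (Z1 k) by apply: gmeasP; case: (Z1_cond kN).
apply: measurable_funD; last exact: measurable_funB.
apply: measurable_funB; last exact: measurable_cst.
have Gz : vgm (G k) (fun t => 2 *: (A k *m (xc k t - ixh (lp tau k t))) - g k t (lp tau k t)).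
  apply: vgmB => //; have := vgm_mulmxl (2 *: A k) (vgmB Gxc Gxh); congr vgm.
  by apply/funext => t; rewrite scalemxAl.
have := vgm_mulmx (vgm_mulmx (vgm_tr Gg) (@vgm_cst _ _ _ (G k) _ _ (Gam sys k.+1))) Gz.
by move=> /(_ 0 0).
Qed.

(** Each observation is a function of noise up to its own time, given that earlier decisions are;
    these are supplied by the induction through their own histories. *)
Lemma imperfect_hist_noise k : (k <= N)%N -> G k `<=` <<s H k >>.
Proof.
elim/ltn_ind: k => k ih kN; apply: hist_gen_sub => j jk.
apply: (vgm_sub (Hmono jk)); have jN := leq_trans jk kN.
have [|_ _ _] := @imperfect_state tau j _ (leqW jN); last by apply.
move=> i ij; have ik := leq_trans ij jk; have iN := leq_trans (ltnW ik) kN.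
by apply: gbool_sub (imperfect_fires_meas iN); exact: ih.
Qed.

Lemma imperfect_adapted j : (j <= N)%N -> gbool (H j) (fire tau j).
Proof.
by move=> jN; apply: gbool_sub (imperfect_fires_meas jN); exact: imperfect_hist_noise.
Qed.

Lemma imperfect_improves :
  (iPsi sys C V m0 M0 x0 w v P tau <= iPsi sys C V m0 M0 x0 w v P (fun k _ _ => dbar k))%E.
Proof.
apply: (@rollout_improves _ _ _ P _ _ sys pQ pR St step (@ix R n) (@ixh R n) w g s0
  stepx stepxh H G _ imperfect_hist_noise _ _ _ _ tau dbar xc Z0 Z1
  imperfect_fires_meas _ _ Z0_cond Z1_cond imperfect_fires_voi).
- by move=> k; exact: noise_gen_measurable.
- by split; [exact: gauss_vec_vL2 mx0 gx0|exact: vL2_cst].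
- by move=> k kN; have [mw gwk] := gw kN; exact: gauss_vec_vL2 mw gwk.
- move=> k kN i; have [mw gwk] := gw kN.
  exact: (@noise_orth _ _ _ P valid F FS Fm indF k n (w k) (Wm sys k) i kN erefl mw gwk).
- move=> trig ad k kN; apply: imperfect_regular => // j jk.
  by apply: ad; rewrite -ltnS (leq_trans jk).
- move=> k kN; have [|_ //] := @imperfect_gain_meas k.
  by move=> j jk; apply: imperfect_fires_meas; rewrite (leq_trans _ kN)// ltnW.
- move=> k kN i; have [|_ Lx _ _] := @imperfect_state tau k _ (leqW kN).
    by move=> j jk; apply: imperfect_adapted; rewrite (leq_trans _ kN)// ltnW.
  apply: orth_cond_exp (xc_cond kN i); last exact: L2_rint (Lx i 0).
  apply: smallest_sub; first exact: sigma_algebra_measurable.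
  move=> E /(imperfect_hist_noise kN); apply: smallest_sub.
    exact: sigma_algebra_measurable.
  exact: noise_gen_measurable.
Qed.

End ImperfectInformation.

Theorem theorem4
  (R : realType) (d : measure_display) (T : measurableType d) (P : probability T R)
  (n m : nat) (sys : lqsys R n m) (m0 : 'cV[R]_n) (M0 : 'M[R]_n)
  (x0 : T -> 'cV[R]_n) (w : nat -> T -> 'cV[R]_n)
  (kp : nat) (dbar : nat -> bool) :
  (* standing assumptions on the system and cost *)
  (forall k, (k <= horizon sys)%N -> pd (Wm sys k)) ->
  (forall k, (k <= (horizon sys).+1)%N -> psd (Qm sys k)) ->
  (forall k, (k <= horizon sys)%N -> pd (Rm sys k)) ->
  (forall k, (k <= horizon sys)%N -> 0 <= theta sys k) ->
  (forall k, (k <= horizon sys)%N -> controllable (Am sys k) (Bm sys k)) ->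
  (* x_0 ~ N(m_0, M_0), w_k ~ N(0, W_k), mutually independent *)
  rv_vec x0 -> gauss_vec P x0 m0 M0 ->
  (forall k, (k <= horizon sys)%N -> rv_vec (w k) /\ gauss_vec P (w k) 0 (Wm sys k)) ->
  mutually_indep P
    (fun i => match i with NX0 => True | NW k => (k <= horizon sys)%N | NV _ => False end)
    (fun i => match i with NX0 => vsigma x0 | NW k => vsigma (w k) | NV _ => set0 end) ->
  (* pibar : periodic triggering policy with period kp *)
  (0 < kp)%N ->
  (forall k, (k + kp <= horizon sys)%N -> dbar (k + kp)%N = dbar k) ->
  (* ---------- perfect information ---------- *)
  (forall rho : nat -> T -> R,
     (forall k, (k <= horizon sys)%N ->
        exists Z0 Z1 : T -> R,
          cond_exp_of P (pIe sys m0 x0 w (pplus sys rho) k)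
                      (pVcf sys m0 x0 w (pplus sys rho) dbar k false) Z0 /\
          cond_exp_of P (pIe sys m0 x0 w (pplus sys rho) k)
                      (pVcf sys m0 x0 w (pplus sys rho) dbar k true) Z1 /\
          forall t, rho k t = Z0 t - Z1 t) ->
     (pPsi sys m0 x0 w P (pplus sys rho) <= pPsi sys m0 x0 w P (fun k _ _ => dbar k))%E)
  /\
  (* ---------- imperfect information ---------- *)
  (forall (p : nat) (C : nat -> 'M[R]_(p, n)) (V : nat -> 'M[R]_p)
          (v : nat -> T -> 'cV[R]_p),
     (forall k, (k <= horizon sys)%N -> pd (V k)) ->
     (forall k, (k <= horizon sys)%N -> observable (Am sys k) (C k)) ->
     (forall k, (k <= horizon sys)%N -> rv_vec (v k) /\ gauss_vec P (v k) 0 (V k)) ->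
     mutually_indep P
       (fun i => match i with NX0 => True | NW k => (k <= horizon sys)%N
                            | NV k => (k <= horizon sys)%N end)
       (fun i => match i with NX0 => vsigma x0 | NW k => vsigma (w k)
                            | NV k => vsigma (v k) end) ->
     forall (xc : nat -> T -> 'cV[R]_n) (rho : nat -> T -> R),
       (* xcheck_k = E[x_k | I^e_k] (Kalman filter estimate) along the pi^+ loop *)
       (forall k, (k <= horizon sys)%N -> forall i : 'I_n,
          cond_exp_of P (iIe sys C V m0 M0 x0 w v (iplus sys C V v rho xc) k)
            (fun t => ix (iclosed sys C V m0 M0 x0 w v (iplus sys C V v rho xc) k t) i 0)
            (fun t => xc k t i 0)) ->
       (* rho_k = varrho^{pibar}_k *)
       (forall k, (k <= horizon sys)%N ->
          exists Z0 Z1 : T -> R,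
            cond_exp_of P (iIe sys C V m0 M0 x0 w v (iplus sys C V v rho xc) k)
              (iVcf sys C V m0 M0 x0 w v (iplus sys C V v rho xc) dbar k false) Z0 /\
            cond_exp_of P (iIe sys C V m0 M0 x0 w v (iplus sys C V v rho xc) k)
              (iVcf sys C V m0 M0 x0 w v (iplus sys C V v rho xc) dbar k true) Z1 /\
            forall t, rho k t = Z0 t - Z1 t) ->
       (iPsi sys C V m0 M0 x0 w v P (iplus sys C V v rho xc)
          <= iPsi sys C V m0 M0 x0 w v P (fun k _ _ => dbar k))%E).
Proof.
move=> _ pQ pR _ _ mx0 gx0 gw indP _ _; split.
  move=> rho hrho.
  (* One version of each conditional expectation is fixed for all times at once; beyond the horizon
     the pair is arbitrary and set to 0. *)
  have /choice[Z hZ] : forall k, exists Z : (T -> R) * (T -> R), (k <= horizon sys)%N ->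
      cond_exp_of P (pIe sys m0 x0 w (pplus sys rho) k)
        (pVcf sys m0 x0 w (pplus sys rho) dbar k false) Z.1 /\
      cond_exp_of P (pIe sys m0 x0 w (pplus sys rho) k)
        (pVcf sys m0 x0 w (pplus sys rho) dbar k true) Z.2 /\
      forall t, rho k t = Z.1 t - Z.2 t.
    move=> k; have [kN|kN] := leqP k (horizon sys); last by exists (cst 0, cst 0).
    by have [Z0 [Z1 hZ]] := hrho k kN; exists (Z0, Z1).
  apply: (perfect_improves pQ pR mx0 gx0 gw indP (Z0 := fun k => (Z k).1)
    (Z1 := fun k => (Z k).2)).
  - by move=> k /hZ[].
  - by move=> k /hZ[_ []].
  - by move=> k t /hZ[_ [_]].
move=> p C V v _ _ gv indI xc rho hxc hrho.
set tau := iplus sys C V v rho xc in hxc hrho *.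
have /choice[Z hZ] : forall k, exists Z : (T -> R) * (T -> R), (k <= horizon sys)%N ->
    cond_exp_of P (iIe sys C V m0 M0 x0 w v tau k)
      (iVcf sys C V m0 M0 x0 w v tau dbar k false) Z.1 /\
    cond_exp_of P (iIe sys C V m0 M0 x0 w v tau k)
      (iVcf sys C V m0 M0 x0 w v tau dbar k true) Z.2 /\
    forall t, rho k t = Z.1 t - Z.2 t.
  move=> k; have [kN|kN] := leqP k (horizon sys); last by exists (cst 0, cst 0).
  by have [Z0 [Z1 hZ]] := hrho k kN; exists (Z0, Z1).
apply: (imperfect_improves pQ pR mx0 gx0 gw gv indI (Z0 := fun k => (Z k).1)
  (Z1 := fun k => (Z k).2)).
- exact: hxc.
- by move=> k /hZ[].
- by move=> k /hZ[_ []].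
- by move=> k t /hZ[_ [_]].
Qed.
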